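(* Let $\alpha\in(0,1)$ and let $a:[0,+\infty)\to\mathbb{R}$ be continuous. Assume that \[ \int_{0}^{+\infty}t|a(t)|\,dt+\sup_{t>0}t^{1-\alpha}\int_{0}^{t}\frac{s|a(s)|}{(t-s)^{1-\alpha}}\,ds<+\infty \] and \[ \frac{1}{\Gamma(\alpha)}\left(\int_{0}^{+\infty}\frac{|a(s)|}{s^{1-\alpha}}\,ds+\chi\right)=k_{3}<1,\qquad \chi=\sup_{t>0}t^{1-\alpha}\int_{0}^{t}\frac{|a(s)|}{(t-s)^{1-\alpha}s^{1-\alpha}}\,ds . \] Then, for any given real numbers $c$ and $b\neq0$, the fractional differential equation \[ {}_{0}D_{t}^{\alpha}\big(t x'(t)-x(t)\big)+a(t)x(t)=0,\qquad t>0, \] has a solution $x\in C^{1}((0,+\infty),\mathbb{R})$ with the asymptotic formula \[ x(t)=[c+O(1)]\,t^{\alpha-1}+bt=bt+O(t^{\alpha-1})\quad\text{as }t\to+\infty . \]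
   Context: $\Gamma$ is Euler's Gamma function. For a function $f\in C((0,+\infty),\mathbb{R})$ with $\lim_{t\searrow 0}t^{1-\alpha}f(t)\in\mathbb{R}$, the Riemann–Liouville derivative of order $\alpha\in(0,1)$ is $({}_{0}D_{t}^{\alpha}f)(t)=\frac{1}{\Gamma(1-\alpha)}\frac{d}{dt}\left[\int_{0}^{t}\frac{f(s)}{(t-s)^{\alpha}}\,ds\right]$, $t>0$. The operator in the equation is the Riemann–Liouville derivative applied to $tx'-x$. (In the paper the constant $c$ is denoted $a$; it is renamed here to avoid a clash with the coefficient $a(t)$.) *)

(* Defs.v *)
From HB Require Import structures.
From mathcomp Require Import all_boot all_order all_algebra.
From mathcomp Require Import all_classical all_reals all_analysis.
Set Implicit Arguments. Unset Strict Implicit. Unset Printing Implicit Defensive.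
Import Order.TTheory GRing.Theory Num.Theory.
Import numFieldNormedType.Exports.
Local Open Scope classical_set_scope.
Local Open Scope ring_scope.

Definition Gamma (R : realType) (z : R) : R :=
  fine (\int[@lebesgue_measure R]_(t in `]0%R, +oo[) ((t `^ (z - 1)) * expR (- t))%:E)%E.

Definition RL_integral_part (R : realType) (alpha : R) (f : R -> R) (t : R) : R :=
  Rintegral (@lebesgue_measure R) `]0%R, t[ (fun s => f s / (t - s) `^ alpha).

Definition RL_deriv (R : realType) (alpha : R) (f : R -> R) (t : R) : R :=
  (Gamma (1 - alpha))^-1 * derive1 (RL_integral_part alpha f) t.

Definition RL_differentiable (R : realType) (alpha : R) (f : R -> R) : Prop :=
  (exists l : R, (fun t => t `^ (1 - alpha) * f t) @ (0%R)^'+ --> l) /\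
  (forall t : R, 0 < t -> derivable (RL_integral_part alpha f) t 1).

(* Main.v *)
Require Import Defs.
From HB Require Import structures.
From mathcomp Require Import all_boot all_order all_algebra.
From mathcomp Require Import all_classical all_reals all_analysis.
From mathcomp Require Import measurable_realfun ring lra.
Set Implicit Arguments. Unset Strict Implicit. Unset Printing Implicit Defensive.
Import Order.TTheory GRing.Theory Num.Theory.
Import numFieldNormedType.Exports.
Local Open Scope classical_set_scope.
Local Open Scope ring_scope.

(** With y = t x' - x the equation reads D^alpha y = - a x, which holds if
    y = - I^alpha (a x), where I^alpha is the Riemann-Liouville integral:
    by the semigroup law I^(1-alpha) (I^alpha g) = I^1 g, whose constant
    B(alpha, 1 - alpha) = Gamma(alpha) Gamma(1 - alpha) comes from Tonelli.
    Conversely y determines x = b t - t \int_t^oo y(s) / s^2 ds up to the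
    choice of b.  So x must be a fixed point of a map built from these two
    integrals.  If |x - z| <= M t^(alpha-1), then the first step multiplies M by
    at most chi / Gamma(alpha) < 1, and the second one does not increase it since
    s^(alpha-1) <= t^(alpha-1) for s >= t; the supremum in the first hypothesis
    bounds the image of b t.  Picard iteration from b t thus converges, to a
    solution with x = b t + O(t^(alpha-1)).  No term c t^(alpha-1) needs to be
    built in, because the O(1) absorbs the constant c. *)

(** * Affine changes of variables *)

Section affine.
Context {R : realType}.
Notation mu := (@lebesgue_measure R).
Variables (k d : R).

Definition affine_map : measurableTypeR R -> measurableTypeR R := fun s => k * s + d.

Lemma measurable_affine : measurable_fun setT affine_map.
Proof. by apply: measurable_funD => //; apply: measurable_funM. Qed.

Let pm : {measure set (measurableTypeR R) -> \bar R}.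
Proof.
unshelve refine (pushforward mu affine_map : {measure set (measurableTypeR R) -> \bar R}).
exact: measurable_affine.
Defined.

(** Lebesgue measure is determined by its values on half-open intervals, and the preimage of ]u, v]
    is an interval of length (v - u) / |k|. For k < 0 the map reverses order, so this preimage is
    closed on the left and open on the right; hence the two cases. *)
Lemma lebesgue_measure_affine : k != 0 -> forall A : set (measurableTypeR R), measurable A ->
  mu A = mscale (NngNum (normr_ge0 k)) pm A.
Proof.
move=> k0 A mA.
apply: lebesgue_measure_unique => //= _ [[u v]] _ <-.
rewrite /mscale/= /pushforward.
case: (ltgtP k 0) k0 => // kn _.
- have -> : affine_map @^-1` `]u, v]%classic = `[(v - d) / k, (u - d) / k[%classic.
    apply/seteqP; split => s /=; rewrite !in_itv/= /affine_map => /andP[h1 h2].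
      by rewrite ler_ndivrMr// ltr_ndivlMr// mulrC; apply/andP; split; lra.
    by move: h1 h2; rewrite ler_ndivrMr// ltr_ndivlMr// mulrC => h1 h2; apply/andP; split; lra.
  rewrite !lebesgue_measure_itv/= !lte_fin ltr_nM2r ?invr_lt0// ltrD2r.
  case: ifPn => uv; last by rewrite mule0.
  rewrite -!EFinB -EFinM ltr0_norm//; congr EFin; field; lra.
- have -> : affine_map @^-1` `]u, v]%classic = `](u - d) / k, (v - d) / k]%classic.
    apply/seteqP; split => s /=; rewrite !in_itv/= /affine_map => /andP[h1 h2].
      by rewrite ltr_pdivrMr// ler_pdivlMr// mulrC; apply/andP; split; lra.
    by move: h1 h2; rewrite ltr_pdivrMr// ler_pdivlMr// mulrC => h1 h2; apply/andP; split; lra.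
  rewrite !lebesgue_measure_itv/= !lte_fin ltr_pM2r ?invr_gt0// ltrD2r.
  case: ifPn => uv; last by rewrite mule0.
  rewrite -!EFinB -EFinM gtr0_norm//; congr EFin; field; lra.
Qed.

Lemma ge0_integral_affine (f : R -> \bar R) : k != 0 ->
  measurable_fun setT f -> (forall x, 0 <= f x)%E ->
  (\int[mu]_x f x = `|k|%:E * \int[mu]_x f (k * x + d)%R)%E.
Proof.
move=> k0 mf f0.
transitivity (\int[mscale (NngNum (normr_ge0 k)) pm]_x f x)%E.
  by apply: eq_measure_integral => A mA _; exact: lebesgue_measure_affine.
by rewrite ge0_integral_mscale// ge0_integral_pushforward//; exact: measurable_affine.
Qed.

Lemma ge0_integral_affine_EFin (f : R -> R) : k != 0 ->
  measurable_fun setT f -> (forall x, 0 <= f x) ->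
  (\int[mu]_x (f x)%:E = `|k|%:E * \int[mu]_x (f (k * x + d))%:E)%E.
Proof.
move=> k0 mf f0; apply: (ge0_integral_affine k0); first exact/measurable_EFinP.
by move=> x; rewrite lee_fin.
Qed.

Lemma integrable_affine (f : R -> R) : k != 0 ->
  mu.-integrable setT (EFin \o f) ->
  mu.-integrable setT (EFin \o (fun x => f (k * x + d))).
Proof.
move=> k0 /integrableP[mf If]; apply/integrableP; split.
  apply/measurable_EFinP; apply: (measurableT_comp _ measurable_affine).
  exact/measurable_EFinP.
move: If; rewrite (ge0_integral_affine k0)//; last exact: measurableT_comp.
have -> : (\int[mu]_x (fun x => `|(EFin \o f) x|) (k * x + d)%R =
  \int[mu]_x `|(EFin \o (fun x => f (k * x + d)%R)) x|)%E by [].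
(* Since |k| > 0, an infinite value of the right-hand integral would make the product infinite. *)
case: (\int[mu]_x _)%E => [r|/=|] //; rewrite ?ltry//.
by rewrite gt0_muley ?ltxx// lte_fin normr_gt0.
Qed.

(** Positive and negative parts are transformed separately by the nonnegative case; integrability
    makes both integrals finite, so that [fine] respects the difference and the product. *)
Lemma Rintegral_affine (f : R -> R) : k != 0 ->
  mu.-integrable setT (EFin \o f) ->
  \int[mu]_x f x = `|k| * \int[mu]_x f (k * x + d).
Proof.
move=> k0 If.
have mf := measurable_int _ If.
have E (g : R -> R) : mu.-integrable setT (EFin \o g) -> \int[mu]_x g x =
    fine (\int[mu]_x (EFin \o g)^\+ x)%E - fine (\int[mu]_x (EFin \o g)^\- x)%E.
  move=> Ig; rewrite -fineB; last 2 first.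
  - exact: (integrable_pos_fin_num measurableT Ig).
  - exact: (integrable_neg_fin_num measurableT Ig).
  by rewrite -integralE.
rewrite E// E; last exact: integrable_affine.
have Ig := integrable_affine k0 If.
have -> : (\int[mu]_x (EFin \o f)^\+ x =
    `|k|%:E * \int[mu]_x (EFin \o (fun x => f (k * x + d)%R))^\+ x)%E.
  rewrite (ge0_integral_affine k0 (measurable_funepos mf))//.
  by congr (_ * _)%E; apply: eq_integral => x _; rewrite !funeposE.
have -> : (\int[mu]_x (EFin \o f)^\- x =
    `|k|%:E * \int[mu]_x (EFin \o (fun x => f (k * x + d)%R))^\- x)%E.
  rewrite (ge0_integral_affine k0 (measurable_funeneg mf))//.
  by congr (_ * _)%E; apply: eq_integral => x _; rewrite !funenegE.
by rewrite !fineM ?mulrBr ?(integrable_neg_fin_num measurableT Ig)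
  ?(integrable_pos_fin_num measurableT Ig).
Qed.
End affine.

(** * The Riemann-Liouville kernel *)

Section kernel.
Context {R : realType}.
Notation mu := (@lebesgue_measure R).
Implicit Types a b s t : R.

(** The cut-off matters: [x `^ p] is [1], not [0], for [x < 0]. *)
Definition rlk (b s : R) : R := if 0 < s then s `^ (b - 1) else 0.

Lemma rlk_gt0 b s : 0 < s -> rlk b s = s `^ (b - 1).
Proof. by rewrite /rlk => ->. Qed.

Lemma rlk_le0 b s : s <= 0 -> rlk b s = 0.
Proof. by rewrite /rlk leNgt => /negbTE ->. Qed.

Lemma rlk_ge0 b s : 0 <= rlk b s.
Proof. by rewrite /rlk; case: ifPn => // _; exact: powR_ge0. Qed.

Lemma measurable_rlk b : measurable_fun setT (rlk b).
Proof.
apply: measurable_fun_if => //.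
- by apply: measurable_fun_ltr.
- by apply: measurable_funTS; exact: measurable_powR.
Qed.

Lemma measurable_rlkB b t : measurable_fun setT (fun s => rlk b (t - s)).
Proof.
by apply: (measurableT_comp (measurable_rlk b)); apply: measurable_funB.
Qed.

Lemma rlkM b k s : 0 < k -> rlk b (k * s) = k `^ (b - 1) * rlk b s.
Proof.
move=> k0; rewrite /rlk pmulr_rgt0//; case: ifPn => s0; last by rewrite mulr0.
by rewrite powRM// ltW.
Qed.

(** The interval ]0, 1] is exhausted by [1/(n+1), 1], where the kernel has the primitive s^b / b.
    Each of these integrals is at most 1/b, and monotone convergence passes the bound to the
    limit. *)
Lemma integral_rlk01 b : 0 < b -> (\int[mu]_(s in `]0%R, 1%R]) (rlk b s)%:E < +oo)%E.
Proof.
move=> b0.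
pose F (n : nat) : set R := `[n.+1%:R^-1, 1]%classic.
have FE : `]0%R, 1%R]%classic = \bigcup_n F n.
  apply/seteqP; split => s /=; rewrite ?in_itv/=.
    move=> /andP[s0 s1]; exists (Num.truncn s^-1) => //; rewrite /F/= in_itv/= s1 andbT.
    by rewrite invf_ple ?posrE// ltW// truncnS_gt.
  move=> [n _]; rewrite /F/= in_itv/= => /andP[ns ->]; rewrite andbT.
  by rewrite (lt_le_trans _ ns).
have mrl : measurable_fun setT (EFin \o rlk b).
  by apply/measurable_EFinP; exact: measurable_rlk.
have ndF : nondecreasing_seq F.
  move=> m n mn; apply/subsetPset => s; rewrite /F/= !in_itv/= => /andP[ms ->].
  by rewrite andbT (le_trans _ ms)// lef_pV2 ?posrE// ler_nat.
have cv := @ge0_nondecreasing_set_cvg_integral _ (measurableTypeR R) R F (EFin \o rlk b) mu ndF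
  (fun=> measurable_itv _) (fun n => measurable_funTS mrl)
  (fun n x _ => rlk_ge0 b x).
rewrite FE.
have -> : (\int[mu]_(s in \bigcup_n F n) (rlk b s)%:E =
   limn (fun n => \int[mu]_(s in F n) (rlk b s)%:E))%E.
  by apply/esym/cvg_lim => //; exact: cv.
apply: (@le_lt_trans _ _ (b^-1)%:E); last by rewrite ltry.
apply: lime_le; first by apply/cvg_ex; eexists; exact: cv.
apply: nearW => n.
(* For n = 0 the interval is the single point 1, which the fundamental theorem, stated for
   nondegenerate intervals, excludes. *)
have [->|n0] := eqVneq n 0%N.
  by rewrite /F invr1 set_itv1 integral_set1 lee_fin invr_ge0 ltW.
have n1 : (n.+1%:R^-1 < 1 :> R) by rewrite invf_lt1// ltr1n ltnS lt0n.
have n00 : (0 < n.+1%:R^-1 :> R) by [].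
have pos s : n.+1%:R^-1 <= s -> 0 < s by move=> /(lt_le_trans n00).
have dF s : 0 < s -> is_derive s 1 (fun s : R => b^-1 * s `^ b) (s `^ (b - 1)).
  move=> s0; have D1 : ((@powR R) ^~ b)^`()%classic s = b * s `^ (b - 1).
    by apply: powR_derive1; rewrite in_itv/= s0.
  have Dd : derivable ((@powR R) ^~ b) s 1 by apply: derivable_powR; rewrite in_itv/= s0.
  have -> : s `^ (b - 1) = b^-1 *: (b * s `^ (b - 1)).
    by rewrite /GRing.scale/= mulKf// gt_eqF.
  apply: is_deriveZ; apply: DeriveDef => //.
  by rewrite -derive1E D1.
rewrite (@continuous_FTC2 _ _ (fun s : R => b^-1 * s `^ b))//.
- by rewrite powR1 mulr1 -EFinB lee_fin gerBl// mulr_ge0 ?powR_ge0// invr_ge0 ltW.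
- apply: (@subspace_eq_continuous _ _ _ (fun s : R => s `^ (b - 1))).
    move=> s; rewrite inE/= in_itv/= => /andP[/pos s0 _].
    by rewrite /from_subspace /= rlk_gt0.
  apply: derivable_within_continuous => s; rewrite in_itv/= => /andP[/pos s0 _].
  by apply: derivable_powR; rewrite in_itv/= s0.
- have cF s : 0 < s -> {for s, continuous (fun s : R => b^-1 * s `^ b)}.
    move=> /dF [D1 _]; apply: differentiable_continuous; exact/derivable1_diffP.
  split.
  + by move=> s; rewrite in_itv/= => /andP[/ltW/pos s0 _]; have [] := dF s s0.
  + by apply: cvg_at_right_filter; exact: cF.
  + by apply: cvg_at_left_filter; exact: cF.
- move=> s; rewrite in_itv/= => /andP[/ltW/pos s0 _].
  by rewrite derive1E; have [_ ->] := dF s s0; rewrite rlk_gt0.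
Qed.
End kernel.

(** * Beta and Gamma integrals *)

Section beta.
Context {R : realType}.
Notation mu := (@lebesgue_measure R).
Implicit Types a b c s t : R.

(** Euler's Beta integral: the cut-offs of the two kernels confine the integrand to ]0, 1[. It is
    kept extended-valued so that Tonelli applies before finiteness is known. *)
Definition rl_beta (a b : R) : \bar R := (\int[mu]_s (rlk a s * rlk b (1 - s))%:E)%E.

Lemma rl_beta_ge0 a b : (0 <= rl_beta a b)%E.
Proof. by apply: integral_ge0 => s _; rewrite lee_fin mulr_ge0// rlk_ge0. Qed.

(** Here v^(b-1) = v^b / v, with v^b <= 1 and 1/v <= 2. *)
Lemma rlk_le2 b v : 0 < b -> 2^-1 <= v -> v <= 1 -> rlk b v <= 2.
Proof.
move=> b0 v2 v1; have v0 : 0 < v by rewrite (lt_le_trans _ v2).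
have E : v `^ (b - 1) = v `^ b / v.
  by rewrite powRB ?(gt_eqF v0) ?implybT// powRr1// ltW.
rewrite rlk_gt0// E ler_pdivrMr//.
have : v `^ b <= 1 by rewrite -(powRr0 v) ger_powR ?v0//= ltW.
by move/le_trans; apply; lra.
Qed.

Lemma integral_rlk_indic b : 0 < b ->
  (\int[mu]_s (rlk b s * \1_(`]0%R, 1%R]%classic) s)%:E < +oo)%E.
Proof.
move=> b0; move: (integral_rlk01 b0); rewrite integral_mkcond.
congr (_ < _)%E; apply: eq_integral => s _.
by rewrite patchE indicE; case: ifPn => _; rewrite ?mulr1 ?mulr0.
Qed.

(** The two singularities are separated at s = 1/2: on either side the regular factor is at most 2,
    so the integrand is dominated by 2 [J a] s + 2 [J b] (1 - s), where [J] is the kernel restricted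
    to ]0, 1]. *)
Lemma rl_beta_lty a b : 0 < a -> 0 < b -> (rl_beta a b < +oo)%E.
Proof.
move=> a0 b0.
pose J c s : R := rlk c s * \1_(`]0%R, 1%R]%classic) s.
have J0 c s : 0 <= J c s by rewrite mulr_ge0// rlk_ge0.
have mJ c : measurable_fun setT (J c).
  by apply: measurable_funM; [exact: measurable_rlk|exact: measurable_indic].
have JE c : (\int[mu]_s (J c s)%:E = \int[mu]_s (J c (- s + 1))%:E)%E.
  have m1 : -1 != 0 :> R by rewrite oppr_eq0 oner_eq0.
  have -> := ge0_integral_affine_EFin 1 m1 (mJ c) (J0 c).
  by rewrite normrN1 mul1e; apply: eq_integral => s _; rewrite mulN1r.
have mJ1 c : measurable_fun setT (fun s => J c (- s + 1)).
  apply: (measurableT_comp (mJ c)); apply: measurable_funD => //.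
apply: (@le_lt_trans _ _ (\int[mu]_s (2 * J a s + 2 * J b (- s + 1))%:E)%E).
  apply: ge0_le_integral => //.
  - by move=> s _; rewrite lee_fin mulr_ge0// rlk_ge0.
  - by apply/measurable_EFinP/measurable_funM; [exact: measurable_rlk|exact: measurable_rlkB].
  - by apply/measurable_EFinP/measurable_funD; apply: measurable_funM => //; [exact: mJ|exact: mJ1].
  - move=> s _; rewrite lee_fin.
    have [s0|s0] := leP s 0; first by rewrite (rlk_le0 _ s0) mul0r addr_ge0// mulr_ge0.
    have [s1|s1] := leP 1 s.
      by rewrite (@rlk_le0 _ b (1 - s)) ?subr_le0// mulr0 addr_ge0// mulr_ge0.
    have Ja : J a s = rlk a s.
      by rewrite /J indicE mem_set ?mulr1//= in_itv/= s0 ltW.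
    have Jb : J b (- s + 1) = rlk b (1 - s).
      rewrite /J indicE mem_set ?mulr1//=; first by rewrite addrC.
      by rewrite in_itv/=; apply/andP; split; lra.
    rewrite Ja Jb.
    have [s2|s2] := leP s 2^-1.
      rewrite -[leLHS]addr0 lerD ?mulr_ge0 ?rlk_ge0//.
      by rewrite mulrC ler_wpM2r ?rlk_ge0// rlk_le2//; lra.
    rewrite -[leLHS]add0r lerD ?mulr_ge0 ?rlk_ge0//.
    by rewrite ler_wpM2r ?rlk_ge0// rlk_le2//; lra.
under eq_integral => s _ do rewrite EFinD (EFinM 2 (J a s)) (EFinM 2 (J b (- s + 1))).
rewrite ge0_integralD//; last 4 first.
- by move=> s _; rewrite mule_ge0// lee_fin.
- by apply: measurable_funeM; apply/measurable_EFinP; exact: mJ.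
- by move=> s _; rewrite mule_ge0// lee_fin.
- by apply: measurable_funeM; apply/measurable_EFinP; exact: mJ1.
rewrite ge0_integralZl//; last 2 first.
- by apply/measurable_EFinP; exact: mJ.
- by move=> s _; rewrite lee_fin.
rewrite ge0_integralZl//; last 2 first.
- by apply/measurable_EFinP; exact: mJ1.
- by move=> s _; rewrite lee_fin.
rewrite -JE lte_add_pinfty//; apply: lte_mul_pinfty => //; exact: integral_rlk_indic.
Qed.

(** The substitution s -> t s takes t^(a-1) and t^(b-1) out of the kernels and a further t out of
    the measure. *)
Let rlk_conv_gt0 a b t : 0 < t ->
  (\int[mu]_s (rlk a s * rlk b (t - s))%:E =
   (t `^ (a + b - 1))%:E * rl_beta a b)%E.
Proof.
move=> t0.
have tn0 : t != 0 by rewrite gt_eqF.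
have mf : measurable_fun setT (fun s => rlk a s * rlk b (t - s)).
  by apply/measurable_funM; [exact: measurable_rlk|exact: measurable_rlkB].
have f0 s : 0 <= rlk a s * rlk b (t - s) by rewrite mulr_ge0// rlk_ge0.
apply: (etrans (ge0_integral_affine_EFin 0 tn0 mf f0)).
have -> : (\int[mu]_s (rlk a (t * s + 0) * rlk b (t - (t * s + 0)))%:E =
   \int[mu]_s ((t `^ (a - 1) * t `^ (b - 1))%:E * (rlk a s * rlk b (1 - s))%:E))%E.
  apply: eq_integral => s _; rewrite -EFinM addr0.
  have -> : t - t * s = t * (1 - s) by ring.
  by rewrite !rlkM//; congr EFin; ring.
rewrite ge0_integralZl//.
- rewrite muleA -EFinM gtr0_norm//; congr (_%:E * _)%E.
  rewrite -[X in X * _](powRr1 (ltW t0)) -!powRD ?(gt_eqF t0) ?implybT//.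
  by congr (_ `^ _); ring.
- by apply/measurable_EFinP/measurable_funM; [exact: measurable_rlk|exact: measurable_rlkB].
- by move=> s _; rewrite lee_fin mulr_ge0// rlk_ge0.
- by rewrite lee_fin mulr_ge0// powR_ge0.
Qed.

Let rlk_conv_le0 a b t : t <= 0 ->
  (\int[mu]_s (rlk a s * rlk b (t - s))%:E = 0)%E.
Proof.
move=> t0; apply: integral0_eq => s _.
have [s0|s0] := leP s 0; first by rewrite (rlk_le0 _ s0) mul0r.
by rewrite (@rlk_le0 _ b) ?mulr0//; lra.
Qed.

Lemma rl_beta_fin b c : 0 < b -> 0 < c -> (fine (rl_beta b c))%:E = rl_beta b c.
Proof. by move=> b0 c0; rewrite fineK// ge0_fin_numE ?rl_beta_ge0// rl_beta_lty. Qed.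

Lemma rlk_conv a b t : (\int[mu]_s (rlk a s * rlk b (t - s))%:E =
  (rlk (a + b) t)%:E * rl_beta a b)%E.
Proof.
have [t0|t0] := leP t 0; first by rewrite rlk_conv_le0// rlk_le0// mul0e.
by rewrite rlk_conv_gt0// rlk_gt0.
Qed.

(** The Gamma integral before [fine] is applied: as [fine] sends an infinite integral to 0,
    finiteness has to be established before [Gamma] can be computed with. *)
Definition Gammae (z : R) : \bar R := (\int[mu]_s (rlk z s * expR (- s))%:E)%E.

Lemma Gamma_Gammae z : Gamma z = fine (Gammae z).
Proof.
rewrite /Gamma /Gammae integral_mkcond; congr fine; apply: eq_integral => s _.
rewrite patchE /rlk; have [s0|s0] := ltP 0 s.
  by rewrite mem_set//= in_itv/= s0.
by rewrite mul0r memNset//= in_itv/= andbT; apply/negP; rewrite -leNgt.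
Qed.

Lemma Gammae_ge0 z : (0 <= Gammae z)%E.
Proof. by apply: integral_ge0 => s _; rewrite lee_fin mulr_ge0// ?rlk_ge0// expR_ge0. Qed.

Lemma measurable_rlk_expR z : measurable_fun setT (fun s : R => rlk z s * expR (- s)).
Proof.
apply: measurable_funM; first exact: measurable_rlk.
by apply: (measurableT_comp (@measurable_expR R)).
Qed.

(** The product is a double integral over s and r. Setting u = s + r turns the exponentials into
    exp(-u), and after Tonelli the integral over s is the convolution of two kernels, computed by
    [rlk_conv]. *)
Lemma GammaeM a b : (Gammae a * Gammae b = rl_beta a b * Gammae (a + b))%E.
Proof.
have m2 (f g : R -> R) (k l : R * R -> R) : measurable_fun setT f -> measurable_fun setT g ->
  measurable_fun setT k -> measurable_fun setT l ->
  measurable_fun setT (fun x => f (k x) * g (l x)).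
  by move=> mf mg mk ml; apply: measurable_funM; apply: measurableT_comp.
transitivity (\int[mu]_s \int[mu]_u (rlk a s * rlk b (u - s) * expR (- u))%:E)%E.
  rewrite muleC /Gammae -ge0_integralZl//; last 3 first.
  - by apply/measurable_EFinP; exact: measurable_rlk_expR.
  - by move=> s _; rewrite lee_fin mulr_ge0// ?rlk_ge0// expR_ge0.
  - exact: Gammae_ge0.
  apply: eq_integral => s _.
  rewrite muleC (@ge0_integral_affine_EFin R 1 (- s) (fun r => rlk b r * expR (- r)))//; last 2 first.
  - exact: measurable_rlk_expR.
  - by move=> r; rewrite mulr_ge0// ?rlk_ge0// expR_ge0.
  rewrite normr1 mul1e -ge0_integralZl//; last 3 first.
  - apply/measurable_EFinP; apply: (measurableT_comp (measurable_rlk_expR b)).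
    by apply: measurable_funD => //; exact: measurable_funM.
  - by move=> r _; rewrite lee_fin mulr_ge0// ?rlk_ge0// expR_ge0.
  - by rewrite lee_fin mulr_ge0// ?rlk_ge0// expR_ge0.
  apply: eq_integral => u _; rewrite -EFinM mul1r; congr EFin.
  have -> : expR (- u) = expR (- s) * expR (- (u - s)) by rewrite -expRD; congr expR; ring.
  ring.
have -> := @fubini_tonelli _ _ (measurableTypeR R) (measurableTypeR R) R mu mu
  (fun x => (rlk a x.1 * rlk b (x.2 - x.1) * expR (- x.2))%:E).
- rewrite /Gammae -ge0_integralZl//; last 3 first.
  + by apply/measurable_EFinP; exact: measurable_rlk_expR.
  + by move=> s _; rewrite lee_fin mulr_ge0// ?rlk_ge0// expR_ge0.
  + exact: rl_beta_ge0.
  apply: eq_integral => u _.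
  rewrite /fubini_G/=.
  under eq_integral do rewrite mulrC EFinM.
  rewrite ge0_integralZl//; last 2 first.
  + by apply/measurable_EFinP/measurable_funM; [exact: measurable_rlk|exact: measurable_rlkB].
  + by move=> s _; rewrite lee_fin mulr_ge0// rlk_ge0.
  by rewrite rlk_conv muleC EFinM muleAC muleC muleA.
- apply/measurable_EFinP/measurable_funM; first apply: m2 => //; try exact: measurable_rlk.
  + by apply: measurable_funB.
  + apply: (measurableT_comp (@measurable_expR R)); exact: (measurable_funN measurable_snd).
- by move=> x; rewrite lee_fin !mulr_ge0// ?rlk_ge0// expR_ge0.
Qed.

Lemma Gammae1 : Gammae 1 = 1%E.
Proof.
rewrite -(integral_exponential_pdf (@ltr01 R)).
transitivity (\int[mu]_(s in `]0%R, +oo[) (expR (- s))%:E)%E.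
  rewrite [RHS]integral_mkcond; apply: eq_integral => s _.
  rewrite patchE /rlk; have [s0|s0] := ltP 0 s.
    by rewrite mem_set/= ?in_itv/= ?s0// subrr powRr0 mul1r.
  by rewrite mul0r memNset//= in_itv/= andbT; apply/negP; rewrite -leNgt.
rewrite integral_itv_obnd_cbnd; last first.
  apply/measurable_EFinP/measurable_funTS.
  by apply: (measurableT_comp (@measurable_expR R)).
rewrite integral_mkcond; apply: eq_integral => s _.
rewrite /exponential_pdf !patchE; case: ifPn => // _.
by rewrite mul1r mulN1r.
Qed.

(** For z <= 1 the integrand is at least exp(-1) on ]0, 1]. *)
Lemma Gammae_gt0 z : z <= 1 -> (0 < Gammae z)%E.
Proof.
move=> z1.
apply: (@lt_le_trans _ _ (\int[mu]_(s in `]0%R, 1%R]) (expR (-1))%:E)%E).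
  rewrite integral_cst//= lebesgue_measure_itv/= lte_fin ltr01 oppr0 adde0 mule1.
  by rewrite lte_fin expR_gt0.
apply: (@le_trans _ _ (\int[mu]_(s in `]0%R, 1%R]) (rlk z s * expR (- s))%:E)%E).
  apply: ge0_le_integral => //.
  - by apply/measurable_EFinP/measurable_funTS; exact: measurable_rlk_expR.
  - move=> s; rewrite /= in_itv/= => /andP[s0 s1]; rewrite lee_fin.
    rewrite rlk_gt0// -[leLHS]mul1r ler_pM ?expR_ge0//.
      by rewrite -[leLHS](powRr0 s) ger_powR ?s0//= subr_le0.
    by rewrite ler_expR lerN2.
apply: ge0_subset_integral => //.
- by apply/measurable_EFinP; exact: measurable_rlk_expR.
- by move=> s _; rewrite lee_fin mulr_ge0// ?rlk_ge0// expR_ge0.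
Qed.

Lemma Gammae_reflection a : 0 < a -> a < 1 ->
  (Gammae a * Gammae (1 - a) = rl_beta a (1 - a))%E.
Proof. by move=> a0 a1; rewrite GammaeM subrKC Gammae1 mule1. Qed.

(** The product with the positive factor [Gammae (1 - a)] is a finite Beta integral, which rules out
    an infinite [Gammae a]. *)
Lemma Gammae_lty a : 0 < a -> a < 1 -> (Gammae a < +oo)%E.
Proof.
move=> a0 a1.
have b1 : 0 < 1 - a by rewrite subr_gt0.
have := rl_beta_lty a0 b1; rewrite -Gammae_reflection//.
have := @Gammae_gt0 (1 - a); have := Gammae_ge0 a.
rewrite gerBl (ltW a0); case: (Gammae a) => [x _ _ _|_ /(_ isT) G|//]; first by rewrite ltry.
by rewrite gt0_mulye.
Qed.

Lemma GammaE a : 0 < a -> a < 1 -> (Gamma a)%:E = Gammae a.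
Proof.
by move=> a0 a1; rewrite Gamma_Gammae fineK// ge0_fin_numE ?Gammae_ge0// Gammae_lty.
Qed.

Lemma Gamma_gt0 a : 0 < a -> a < 1 -> 0 < Gamma a.
Proof. by move=> a0 a1; rewrite -lte_fin GammaE// Gammae_gt0// ltW. Qed.

Lemma Gamma_reflection a : 0 < a -> a < 1 ->
  (Gamma a * Gamma (1 - a))%:E = rl_beta a (1 - a).
Proof.
move=> a0 a1; rewrite EFinM !GammaE// ?Gammae_reflection ?subr_gt0//.
by rewrite gtrBl.
Qed.
End beta.

(** * Convolution with the kernel *)

Section rlconv.
Context {R : realType}.
Notation mu := (@lebesgue_measure R).
Implicit Types (a b s t : R) (g h : R -> R).

Definition cutpos (g : R -> R) (s : R) : R := if 0 < s then g s else 0.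

Lemma cutpos_gt0 g s : 0 < s -> cutpos g s = g s.
Proof. by rewrite /cutpos => ->. Qed.

Lemma cutpos_le0 g s : s <= 0 -> cutpos g s = 0.
Proof. by rewrite /cutpos leNgt => /negbTE ->. Qed.

(** The growth class for which all convolutions below converge: at most s^(a-1) near 0, and bounded
    on compact subsets of the open half-line. The constant may depend on T, so nothing is imposed at
    infinity. *)
Definition tame a g := measurable_fun setT (cutpos g) /\
  forall T, 0 < T -> exists2 C, 0 <= C & forall s, 0 < s -> s <= T -> `|g s| <= C * s `^ (a - 1).

(** [Gamma b] times the Riemann-Liouville integral of order [b], written as a
    convolution over the whole line so that Fubini and affine changes of
    variables apply without tracking domains (see [rlconvE]). *)
Definition rlconv b g t : R := \int[mu]_s (cutpos g s * rlk b (t - s)).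

Lemma measurable_rlconv_integrand b g t : measurable_fun setT (cutpos g) ->
  measurable_fun setT (fun s => cutpos g s * rlk b (t - s)).
Proof. by move=> mg; apply: measurable_funM => //; exact: measurable_rlkB. Qed.

Lemma rlconv_integrand_le a b g t C : 0 <= C ->
  (forall s, 0 < s -> s <= t -> `|g s| <= C * s `^ (a - 1)) ->
  forall s, `|cutpos g s * rlk b (t - s)| <= C * (rlk a s * rlk b (t - s)).
Proof.
move=> C0 gC s; rewrite normrM (ger0_norm (rlk_ge0 _ _)) mulrA.
have [s0|s0] := leP s 0.
  by rewrite cutpos_le0// normr0 mul0r !mulr_ge0// rlk_ge0.
have [st|st] := leP t s.
  by rewrite (@rlk_le0 _ b) ?subr_le0// !mulr0.
rewrite ler_wpM2r ?rlk_ge0// cutpos_gt0// rlk_gt0//.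
by apply: gC => //; exact: ltW.
Qed.

Lemma integral_rlconv_norm_le a b g t C : 0 <= C -> measurable_fun setT (cutpos g) ->
  (forall s, 0 < s -> s <= t -> `|g s| <= C * s `^ (a - 1)) ->
  (\int[mu]_s `|cutpos g s * rlk b (t - s)|%:E <=
   C%:E * ((rlk (a + b) t)%:E * rl_beta a b))%E.
Proof.
move=> C0 mg gC; rewrite -rlk_conv -ge0_integralZl//; last 2 first.
- by apply/measurable_EFinP/measurable_funM; [exact: measurable_rlk|exact: measurable_rlkB].
- by move=> s _; rewrite lee_fin mulr_ge0// rlk_ge0.
apply: ge0_le_integral => //.
- by apply/measurable_EFinP/measurableT_comp => //; exact: measurable_rlconv_integrand.
- apply: measurable_funeM.
  by apply/measurable_EFinP/measurable_funM; [exact: measurable_rlk|exact: measurable_rlkB].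
- by move=> s _; rewrite -EFinM lee_fin (rlconv_integrand_le b C0 gC).
Qed.

Lemma tame_integrable a b g t : 0 < a -> 0 < b -> tame a g ->
  mu.-integrable setT (EFin \o (fun s => cutpos g s * rlk b (t - s))).
Proof.
move=> a0 b0 [mg gT]; apply/integrableP; split.
  by apply/measurable_EFinP; exact: measurable_rlconv_integrand.
(* The maximum with 1 supplies a positive bound even when t <= 0. *)
have T0 : 0 < Num.max t 1 by rewrite lt_max ltr01 orbT.
have [C C0 gC] := gT _ T0.
have {}gC s : 0 < s -> s <= t -> `|g s| <= C * s `^ (a - 1).
  by move=> s0 st; apply: gC => //; rewrite le_max st.
apply: le_lt_trans (integral_rlconv_norm_le b C0 mg gC) _.
have := rl_beta_lty a0 b0; have := rl_beta_ge0 a b.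
case: (rl_beta a b) => [r _ _|//|//].
by rewrite -!EFinM ltry.
Qed.

Lemma rlconv_le a b g t C : 0 < a -> 0 < b -> tame a g -> 0 < t -> 0 <= C ->
  (forall s, 0 < s -> s <= t -> `|g s| <= C * s `^ (a - 1)) ->
  `|rlconv b g t| <= C * fine (rl_beta a b) * t `^ (a + b - 1).
Proof.
move=> a0 b0 tg t0 C0 gC.
apply: le_trans (le_normr_Rintegral _ (tame_integrable t a0 b0 tg)) _ => //.
have le := integral_rlconv_norm_le b C0 tg.1 gC.
rewrite rlk_gt0// -rl_beta_fin// -!EFinM in le.
rewrite -lee_fin /Rintegral fineK.
  by apply: le_trans le _; rewrite lee_fin -mulrA [t `^ _ * _]mulrC.
by rewrite ge0_fin_numE ?(le_lt_trans le) ?ltry// integral_ge0.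
Qed.

Lemma rlconv_le0 b g t : t <= 0 -> rlconv b g t = 0.
Proof.
move=> t0; rewrite /rlconv /Rintegral integral0_eq// => s _.
have [s0|s0] := leP s 0; first by rewrite cutpos_le0// mul0r.
by rewrite (@rlk_le0 _ b) ?mulr0//; lra.
Qed.

Lemma cutpos_rlconv b g t : cutpos (rlconv b g) t = rlconv b g t.
Proof. by rewrite /cutpos; case: ltP => // t0; rewrite rlconv_le0. Qed.

Lemma eq_rlconv b g h t : (forall s, 0 < s -> g s = h s) -> rlconv b g t = rlconv b h t.
Proof.
move=> gh; apply: eq_Rintegral => s _; congr (_ * _); rewrite /cutpos.
by case: ifPn => // /gh.
Qed.

Lemma rlconvE b g t :
  rlconv b g t = \int[mu]_(s in `]0%R, t[) (g s / (t - s) `^ (1 - b)).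
Proof.
rewrite [RHS]Rintegral_mkcond; apply: eq_Rintegral => s _.
rewrite patchE; case: ifPn.
  rewrite inE/= in_itv/= => /andP[s0 st].
  rewrite cutpos_gt0// rlk_gt0 ?subr_gt0//; congr (_ * _).
  by rewrite -powRN; congr (_ `^ _); ring.
rewrite notin_setE/= in_itv/= => /negP; rewrite negb_and -!leNgt => /orP[s0|st].
  by rewrite cutpos_le0// mul0r.
by rewrite rlk_le0 ?mulr0// subr_le0.
Qed.

Lemma rlconvB a b g h t : 0 < a -> 0 < b -> tame a g -> tame a h ->
  rlconv b (g \- h) t = rlconv b g t - rlconv b h t.
Proof.
move=> a0 b0 tg th.
rewrite /rlconv -RintegralB//; [|exact: tame_integrable tg|exact: tame_integrable th].
apply: eq_Rintegral => s _; rewrite -mulrBl; congr (_ * _); rewrite /cutpos /=.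
by case: ifPn => // _; rewrite subrr.
Qed.

(** No growth condition near 0 is assumed: the bound on the integral of the absolute value itself
    provides integrability. *)
Lemma rlconv_itv_le b g t (M : R) : 0 < t -> measurable_fun setT (cutpos g) ->
  (\int[mu]_(s in `]0%R, t[) (`|g s| / (t - s) `^ (1 - b))%:E <= M%:E)%E ->
  `|rlconv b g t| <= M.
Proof.
move=> t0 mg gM.
have E : (\int[mu]_(s in `]0%R, t[) (`|g s| / (t - s) `^ (1 - b))%:E =
   \int[mu]_s `|cutpos g s * rlk b (t - s)|%:E)%E.
  rewrite integral_mkcond; apply: eq_integral => s _.
  rewrite patchE; case: ifPn.
    rewrite inE/= in_itv/= => /andP[s0 st].
    rewrite cutpos_gt0// rlk_gt0 ?subr_gt0// normrM; congr (_ * _)%:E.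
    rewrite ger0_norm ?powR_ge0//.
    by rewrite -powRN; congr (_ `^ _); ring.
  rewrite notin_setE/= in_itv/= => /negP; rewrite negb_and -!leNgt => /orP[s0|st].
    by rewrite cutpos_le0// mul0r normr0.
  by rewrite rlk_le0 ?mulr0 ?normr0// subr_le0.
have i : mu.-integrable setT (EFin \o (fun s => cutpos g s * rlk b (t - s))).
  apply/integrableP; split.
    by apply/measurable_EFinP; exact: measurable_rlconv_integrand.
  by apply: le_lt_trans (ltry M); rewrite -E in gM *.
apply: le_trans (le_normr_Rintegral _ i) _ => //.
rewrite /Rintegral -E.
have : (0 <= \int[mu]_(s in `]0%R, t[) (`|g s| / (t - s) `^ (1 - b))%:E)%E.
  by apply: integral_ge0 => s _; rewrite lee_fin mulr_ge0// invr_ge0 powR_ge0.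
by move: gM; case: (\int[mu]_(s in _) _)%E => //= x; rewrite lee_fin.
Qed.
End rlconv.

(** * Semigroup law for Riemann-Liouville integrals *)

Section semigroup.
Context {R : realType}.
Notation mu := (@lebesgue_measure R).
Implicit Types (a b c s t r : R) (g h : R -> R).

Lemma rlk_conv_shift b c r t : (\int[mu]_s (rlk b (s - r) * rlk c (t - s))%:E =
  (rlk (b + c) (t - r))%:E * rl_beta b c)%E.
Proof.
have mf : measurable_fun setT (fun s => rlk b (s - r) * rlk c (t - s)).
  apply: measurable_funM; last exact: measurable_rlkB.
  by apply: (measurableT_comp (measurable_rlk b)); apply: measurable_funB.
have f0 s : 0 <= rlk b (s - r) * rlk c (t - s) by rewrite mulr_ge0// rlk_ge0.
apply: (etrans (ge0_integral_affine_EFin r (oner_neq0 R) mf f0)).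
rewrite normr1 mul1e -rlk_conv; apply: eq_integral => s _.
by rewrite mul1r addrK opprD addrA addrAC.
Qed.

Lemma integrable_rlk_conv_shift b c r t : 0 < b -> 0 < c ->
  mu.-integrable setT (EFin \o (fun s => rlk b (s - r) * rlk c (t - s))).
Proof.
move=> b0 c0; apply/integrableP; split.
  apply/measurable_EFinP/measurable_funM; last exact: measurable_rlkB.
  by apply: (measurableT_comp (measurable_rlk b)); apply: measurable_funB.
under eq_integral do rewrite /= ger0_norm ?mulr_ge0 ?rlk_ge0//.
rewrite rlk_conv_shift; have := rl_beta_lty b0 c0; have := rl_beta_ge0 b c.
by case: (rl_beta b c) => [x _ _|//|//]; rewrite -EFinM ltry.
Qed.

(** Fubini on the double integral over s and r: integrating in s first leaves the convolution of two
    shifted kernels, that is, B(b, c) times the kernel of order b + c. The same computation with |g|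
    shows integrability on the product, since g is tame. *)
Lemma rlconv_rlconv a b c g t : 0 < a -> 0 < b -> 0 < c -> tame a g ->
  rlconv c (rlconv b g) t = fine (rl_beta b c) * rlconv (b + c) g t.
Proof.
move=> a0 b0 c0 tg; have mg := tg.1.
have bc0 : 0 < b + c by rewrite addr_gt0.
pose T := measurableTypeR R.
pose f (x : T * T) : R := cutpos g x.2 * (rlk b (x.1 - x.2) * rlk c (t - x.1)).
have mf : measurable_fun setT (EFin \o f).
  apply/measurable_EFinP/measurable_funM; first exact: measurableT_comp.
  apply: measurable_funM.
    by apply: (measurableT_comp (measurable_rlk b)); apply: measurable_funB.
  by apply: (measurableT_comp (measurable_rlk c)); apply: measurable_funB.
have GE r : (\int[mu]_s (f (s, r))%:E =
    (fine (rl_beta b c) * (cutpos g r * rlk (b + c) (t - r)))%:E)%E.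
  transitivity (\int[mu]_s ((cutpos g r)%:E *
      (EFin \o (fun s => rlk b (s - r) * rlk c (t - s))%R) s))%E.
    by apply: eq_integral => s _; rewrite /= -EFinM.
  rewrite (integralZl measurableT (integrable_rlk_conv_shift r t b0 c0)).
  rewrite [X in (_ * X)%E](rlk_conv_shift b c r t).
  by rewrite -rl_beta_fin// -!EFinM; congr EFin; ring.
have FE s : (\int[mu]_r (f (s, r))%:E = (rlconv b g s * rlk c (t - s))%:E)%E.
  have i := tame_integrable s a0 b0 tg.
  transitivity (\int[mu]_r ((rlk c (t - s))%:E * (cutpos g r * rlk b (s - r))%:E))%E.
    by apply: eq_integral => r _; rewrite -EFinM /f/=; congr EFin; ring.
  rewrite integralZl// [RHS]EFinM muleC /rlconv /Rintegral fineK//.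
  exact: (integrable_fin_num measurableT i).
have If : (product_measure1 mu mu).-integrable setT (EFin \o f).
  apply: (iffRL (@integrable21ltyP _ _ _ _ R mu mu _ mf)).
  under eq_integral => r _.
    have -> : (\int[mu]_s `|(EFin \o f) (s, r)| =
        `|(cutpos g r * rlk (b + c) (t - r))|%:E * rl_beta b c)%E.
      transitivity (\int[mu]_s (`|cutpos g r|%:E * (rlk b (s - r) * rlk c (t - s))%:E))%E.
        apply: eq_integral => s _ /=; rewrite -EFinM; congr EFin.
        by rewrite normrM; congr (_ * _); rewrite ger0_norm// mulr_ge0 ?rlk_ge0.
      rewrite (integralZl measurableT (integrable_rlk_conv_shift r t b0 c0)).
      by rewrite [X in (_ * X)%E](rlk_conv_shift b c r t) muleA -EFinM normrM (ger0_norm (rlk_ge0 _ _)).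
    over.
  rewrite -rl_beta_fin// ge0_integralZr//; last 2 first.
  - apply/measurable_EFinP/measurableT_comp => //.
    exact: measurable_rlconv_integrand.
  - by rewrite lee_fin fine_ge0// rl_beta_ge0.
  rewrite lte_mul_pinfty//.
  - by apply: integral_ge0 => r _; rewrite lee_fin.
  - have /integrableP[_ fin] := tame_integrable t a0 bc0 tg.
    by rewrite ge0_fin_numE ?integral_ge0.
  - exact: ltry.
rewrite /rlconv -RintegralZl//; last exact: tame_integrable tg.
rewrite /Rintegral.
have := Fubini If; rewrite /fubini_F /fubini_G => FG.
transitivity (fine (\int[mu]_s \int[mu]_r (f (s, r))%:E)%E).
  congr fine; apply: eq_integral => s _.
  by rewrite FE -/(rlconv b g) cutpos_rlconv.
rewrite [X in fine X]FG; congr fine; apply: eq_integral => r _.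
by rewrite GE.
Qed.
End semigroup.

(** * Continuity of the fractional integral, and its derivative at order one *)

Section continuity.
Context {R : realType}.
Notation mu := (@lebesgue_measure R).
Implicit Types (a b c s t r : R) (g h : R -> R).

Lemma continuous_cutpos g s : 0 < s -> {for s, continuous g} -> {for s, continuous (cutpos g)}.
Proof.
move=> s0 cg; rewrite /prop_for /continuous_at (cutpos_gt0 _ s0).
apply: cvg_trans cg; apply: near_eq_cvg; near=> x.
by rewrite cutpos_gt0//; near: x; exact: lt_nbhsr.
Unshelve. all: by end_near. Qed.

Lemma measurable_cutpos g : (forall s, 0 < s -> {for s, continuous g}) ->
  measurable_fun setT (cutpos g).
Proof.
move=> cg.
have -> : cutpos g = g \_ `]0, +oo[%classic.
  apply/funext => s; rewrite /cutpos patchE; case: ltP => s0.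
    by rewrite mem_set//= in_itv/= s0.
  by rewrite memNset//= in_itv/= andbT; apply/negP; rewrite -leNgt.
apply/(measurable_restrictT g) => //.
apply: open_continuous_measurable_fun; first exact: interval_open.
by move=> s; rewrite inE/= in_itv/= andbT; exact: cg.
Qed.

(** Putting s = t v fixes the singularity of the kernel at v = 1 and moves the dependence on t into
    the argument of g, where dominated convergence can handle it. *)
Lemma rlconv_scale a b g t : 0 < a -> 0 < b -> tame a g -> 0 < t ->
  rlconv b g t = t `^ b * \int[mu]_v (cutpos g (t * v) * rlk b (1 - v)).
Proof.
move=> a0 b0 tg t0; have tn0 : t != 0 by rewrite gt_eqF.
have i := tame_integrable t a0 b0 tg.
have j := integrable_affine 0 tn0 i.
rewrite /rlconv (Rintegral_affine 0 tn0 i).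
have E v : cutpos g (t * v + 0) * rlk b (t - (t * v + 0)) =
    t `^ (b - 1) * (cutpos g (t * v) * rlk b (1 - v)).
  have -> : t - (t * v + 0) = t * (1 - v) by ring.
  by rewrite rlkM// addr0; ring.
have p0 : t `^ (b - 1) != 0 by rewrite gt_eqF// powR_gt0.
have k : mu.-integrable setT (EFin \o (fun v => cutpos g (t * v) * rlk b (1 - v))).
  have := integrableZl measurableT (t `^ (b - 1))^-1 j.
  apply: eq_integrable => // v _ /=.
  by rewrite E -EFinM mulKf.
under eq_Rintegral do rewrite E.
rewrite RintegralZl// mulrA gtr0_norm//; congr (_ * _).
by rewrite mulr_powRB1// ltW.
Qed.

Lemma rlconv_continuous a b g t : 0 < a -> a <= 1 -> 0 < b -> tame a g ->
  (forall s, 0 < s -> {for s, continuous g}) -> 0 < t ->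
  {for t, continuous (rlconv b g)}.
Proof.
move=> a0 a1 b0 tg cg t0.
pose H x := \int[mu]_v (cutpos g (x * v) * rlk b (1 - v)).
have cgv (x v : R) : 0 < x -> {for x, continuous (fun y : R => cutpos g (y * v))}.
  move=> x0; have [vn|vp] := leP v 0.
    rewrite /prop_for /continuous_at cutpos_le0; last by rewrite pmulr_rle0.
    apply: cvg_near_cst; near=> y; rewrite cutpos_le0// pmulr_rle0//.
    by near: y; exact: lt_nbhsr.
  have xv0 : 0 < x * v by rewrite mulr_gt0.
  apply: (@continuous_comp R R R (fun y => y * v) (cutpos g)).
    exact: mulrr_continuous.
  by apply: continuous_cutpos => //; exact: cg.
suff cH : {for t, continuous H}.
  rewrite /prop_for /continuous_at (rlconv_scale a0 b0 tg t0).
  apply: (@cvg_trans _ ((fun x => x `^ b * H x) @ t)).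
    apply: near_eq_cvg; near=> x; rewrite (rlconv_scale a0 b0 tg)//.
    by near: x; exact: lt_nbhsr.
  have cp : {for t, continuous (fun x : R => x `^ b)}.
    apply: differentiable_continuous; apply/derivable1_diffP.
    by apply: derivable_powR; rewrite in_itv/= t0.
  exact: (continuousM cp cH).
have u0 : 0 < t / 2 by rewrite divr_gt0.
have v0 : 0 < t * 2 by rewrite mulr_gt0.
have [C C0 gC] := tg.2 _ v0.
have It : t \in `]t / 2, t * 2[%classic.
  by rewrite inE/= in_itv/=; apply/andP; split; lra.
(* As a <= 1 and x > t/2, for 0 < v < 1 one has |g (x v)| <= C (x v)^(a-1) <= C (t/2)^(a-1) v^(a-1),
   and the majorant is a multiple of the Beta integrand. The constant C is taken on ]0, 2t], which
   contains x v. *)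
have dom x v : t / 2 < x -> x < t * 2 -> `|cutpos g (x * v) * rlk b (1 - v)| <=
    (C * (t / 2) `^ (a - 1)) * (rlk a v * rlk b (1 - v)).
  move=> ux xv; have x0 := lt_trans u0 ux.
  have D0 : 0 <= C * (t / 2) `^ (a - 1) by rewrite mulr_ge0// powR_ge0.
  rewrite normrM (ger0_norm (rlk_ge0 _ _)) mulrA.
  have [v1|v1] := leP 1 v; first by rewrite (@rlk_le0 _ b) ?subr_le0// !mulr0.
  rewrite ler_wpM2r ?rlk_ge0//.
  have [vn|vp] := leP v 0.
    have xv0 : x * v <= 0 by rewrite pmulr_rle0.
    by rewrite (cutpos_le0 _ xv0) normr0 mulr_ge0 ?rlk_ge0.
  have xv0 : 0 < x * v by rewrite mulr_gt0.
  rewrite cutpos_gt0//; apply: le_trans (gC _ xv0 _) _.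
    by rewrite -[leRHS]mulr1 ler_pM// ltW.
  rewrite rlk_gt0// (powRM _ (ltW x0) (ltW vp)) -!mulrA ler_wpM2l// ler_wpM2r ?powR_ge0//.
  rewrite -(opprB 1 a) !powRN lef_pV2 ?posrE ?powR_gt0//.
  by rewrite ge0_ler_powR ?nnegrE ?subr_ge0// ltW.
have idom : mu.-integrable setT (EFin \o
    (fun v => (C * (t / 2) `^ (a - 1)) * (rlk a v * rlk b (1 - v)))).
  have := @integrable_rlk_conv_shift R a b 0 1 a0 b0.
  move=> /(integrableZl measurableT (C * (t / 2) `^ (a - 1))).
  by apply: eq_integrable => // v _ /=; rewrite subr0.
have mi (x : R) : measurable_fun setT (fun v : R => cutpos g (x * v) * rlk b (1 - v)).
  apply: measurable_funM; last exact: measurable_rlkB.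
  by apply: (measurableT_comp tg.1); exact: measurable_funM.
apply: (@continuity_under_integral R _ _ mu
  (fun x v => cutpos g (x * v) * rlk b (1 - v)) setT measurableT (t / 2) (t * 2) _ _
  (fun v => (C * (t / 2) `^ (a - 1)) * (rlk a v * rlk b (1 - v))) idom _ t It).
- move=> x; rewrite /= in_itv/= => /andP[ux xv].
  apply: le_integrable idom => //; first by apply/measurable_EFinP; exact: mi.
  by move=> v _; rewrite /= lee_fin (le_trans (dom _ _ ux xv))// ler_norm.
- apply: aeW => v _ x; rewrite inE/= in_itv/= => /andP[ux _].
  apply: (@continuous_comp R R R (fun y => cutpos g (y * v)) ( *%R^~ (rlk b (1 - v)))).
    exact: cgv (lt_trans u0 ux).
  exact: mulrr_continuous.
- move=> x; rewrite /= in_itv/= => /andP[ux xv].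
  by apply: aeW => v _; exact: dom.
Unshelve. all: by end_near. Qed.

(** The kernel of order one is the indicator of s < t, so the convolution is the primitive of g from
    0. *)
Lemma is_derive_rlconv1 a g t : 0 < a -> tame a g -> 0 < t ->
  {for t, continuous g} -> is_derive t 1 (rlconv 1 g) (g t).
Proof.
move=> a0 tg t0 cg.
(* The convolution is taken at u + 1, where the kernel equals 1 on all of ]0, u], endpoint u
   included. *)
have i u : mu.-integrable `]0, u] (EFin \o cutpos g).
  have := tame_integrable (u + 1) a0 ltr01 tg.
  move=> /(@integrableS _ _ _ mu _ `]0, u]) => /(_ measurableT (measurable_itv _) (@subsetT _ _)).
  apply: eq_integrable => // s; rewrite inE/= in_itv/= => /andP[_ su].
  by rewrite rlk_gt0 ?subrr ?powRr0 ?mulr1//; lra.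
have E : rlconv 1 g = fun t => \int[mu]_(s in [set` Interval (BRight 0) (BRight t)]) cutpos g s.
  apply/funext => u; rewrite rlconvE -Rintegral_itv_bndo_bndc.
    apply: eq_Rintegral => s; rewrite inE/= in_itv/= => /andP[s0 _].
    by rewrite cutpos_gt0// subrr powRr0 divr1.
  apply: integrableS (i u) => //; apply: subset_itvl.
  by rewrite bnd_simp.
have t1 : t < t + 1 by rewrite ltrDl.
have lt0 : (BRight 0 < BRight t)%O by rewrite bnd_simp.
have [] := continuous_FTC1 t1 (i _) lt0 (continuous_cutpos t0 cg).
rewrite -E => D1 D2; apply: DeriveDef => //.
by rewrite -derive1E D2 cutpos_gt0.
Qed.
End continuity.

(** * The tail integral *)

Section tail.
Context {R : realType}.
Notation mu := (@lebesgue_measure R).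
Implicit Types (a s t M : R) (y z : R -> R).

Lemma is_derive_inv_opp s : 0 < s -> is_derive s 1 (fun s : R => - s^-1) (s ^- 2).
Proof.
move=> s0; have sn0 : s != 0 by rewrite gt_eqF.
have D := @is_deriveV R (@id R) s 1 1 sn0 (is_derive_id s 1).
by have := is_deriveN D; rewrite /GRing.scale/= mulr1 opprK.
Qed.

Lemma continuous_invsqr s : 0 < s -> {for s, continuous (fun s : R => s ^- 2)}.
Proof.
move=> s0; apply: cvgV; first by rewrite sqrf_eq0 gt_eqF.
exact: exprn_continuous.
Qed.

Lemma integral_invsqr t : 0 < t ->
  (\int[mu]_(s in `]t, +oo[) (s ^- 2)%:E = (t^-1)%:E)%E.
Proof.
move=> t0.
have cont := continuous_invsqr.
rewrite integral_itv_obnd_cbnd; last first.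
  apply/measurable_EFinP; apply: open_continuous_measurable_fun; first exact: interval_open.
  by move=> s; rewrite inE/= in_itv/= andbT => /(lt_trans t0); exact: cont.
rewrite (@ge0_continuous_FTC2y R (fun s => s ^- 2) (fun s => - s^-1) t 0).
- by rewrite -EFinB sub0r opprK.
- by move=> s _; rewrite invr_ge0 sqr_ge0.
- apply/continuous_within_itvcyP; split.
    by move=> s; rewrite in_itv/= andbT => /(lt_trans t0); exact: cont.
  by apply: cvg_at_right_filter; exact: cont.
- apply/cvgrPdist_lt => e e0; near=> x.
  have ex : e^-1 < x by near: x; apply: nbhs_pinfty_gt; exact: num_real.
  have x0 : 0 < x by rewrite (lt_trans _ ex)// invr_gt0.
  by rewrite sub0r opprK gtr0_norm ?invr_gt0// invf_plt ?posrE.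
- by move=> s ts; have [] := is_derive_inv_opp (lt_trans t0 ts).
- have cF : {for t, continuous (fun s : R => - s^-1)}.
    apply: differentiable_continuous.
    by apply/derivable1_diffP; have [] := is_derive_inv_opp t0.
  exact: cvg_at_right_filter.
- move=> s; rewrite in_itv/= andbT => ts.
  by have [_ <-] := is_derive_inv_opp (lt_trans t0 ts); rewrite derive1E.
Unshelve. all: by end_near. Qed.

(** Since (x / t)' = (t x' - x) / t^2, this tail recovers x / t, up to its limit at infinity, from y
    = t x' - x. *)
Definition rltail y t : R := \int[mu]_(s in `]t, +oo[) (y s / s ^+ 2).

Section bounded.
Variables (a M : R) (y : R -> R).
Hypothesis a1 : a <= 1.
Hypothesis M0 : 0 <= M.
Hypothesis my : measurable_fun setT (cutpos y).
Hypothesis yM : forall s, 0 < s -> `|y s| <= M * s `^ (a - 1).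

Let measurable_tail t : 0 < t -> measurable_fun `]t, +oo[ (fun s => y s / s ^+ 2).
Proof.
move=> t0.
have E : {in `]t, +oo[%classic, (fun s => cutpos y s * s ^- 2) =1 (fun s => y s / s ^+ 2)}.
  by move=> s; rewrite inE/= in_itv/= andbT => /(lt_trans t0) s0; rewrite cutpos_gt0.
apply: (eq_measurable_fun _ E); apply: measurable_funM; first exact: measurable_funTS.
apply: open_continuous_measurable_fun; first exact: interval_open.
move=> s; rewrite inE/= in_itv/= andbT => /(lt_trans t0) s0.
exact: continuous_invsqr.
Qed.

Let tail_le t : 0 < t ->
  (\int[mu]_(s in `]t, +oo[) `|y s / s ^+ 2|%:E <= (M * t `^ (a - 1) / t)%:E)%E.
Proof.
move=> t0.
apply: (@le_trans _ _ (\int[mu]_(s in `]t, +oo[) ((M * t `^ (a - 1))%:E * (s ^- 2)%:E))%E).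
  apply: ge0_le_integral => //.
  - by apply/measurable_EFinP/measurableT_comp => //; exact: measurable_tail.
  - apply: measurable_funeM; apply/measurable_EFinP.
    apply: open_continuous_measurable_fun; first exact: interval_open.
    move=> s; rewrite inE/= in_itv/= andbT => /(lt_trans t0) s0.
    exact: continuous_invsqr.
  - move=> s; rewrite /= in_itv/= andbT => ts; have s0 := lt_trans t0 ts.
    rewrite -EFinM lee_fin normrM [`|_ ^-1|]ger0_norm ?invr_ge0 ?sqr_ge0//.
    rewrite ler_wpM2r ?invr_ge0 ?sqr_ge0//; apply: le_trans (yM s0) _.
    rewrite ler_wpM2l// -(opprB 1 a) !powRN lef_pV2 ?posrE ?powR_gt0//.
    by rewrite ge0_ler_powR ?nnegrE ?subr_ge0// ltW.
rewrite ge0_integralZl//.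
- by rewrite integral_invsqr// -EFinM.
- apply/measurable_EFinP.
  apply: open_continuous_measurable_fun; first exact: interval_open.
  move=> s; rewrite inE/= in_itv/= andbT => /(lt_trans t0) s0.
  exact: continuous_invsqr.
- by move=> s _; rewrite lee_fin invr_ge0 sqr_ge0.
- by rewrite lee_fin mulr_ge0// powR_ge0.
Qed.

Lemma integrable_rltail t : 0 < t ->
  mu.-integrable `]t, +oo[ (EFin \o (fun s => y s / s ^+ 2)).
Proof.
move=> t0; apply/integrableP; split; first by apply/measurable_EFinP; exact: measurable_tail.
by apply: le_lt_trans (tail_le t0) _; rewrite ltry.
Qed.

Lemma rltail_le t : 0 < t -> `|t * rltail y t| <= M * t `^ (a - 1).
Proof.
move=> t0; rewrite normrM gtr0_norm// mulrC -ler_pdivlMr//.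
apply: le_trans (le_normr_Rintegral _ (integrable_rltail t0)) _ => //.
have le := tail_le t0.
rewrite -lee_fin /Rintegral fineK//.
by rewrite ge0_fin_numE ?(le_lt_trans le) ?ltry// integral_ge0.
Qed.

(** Near t the tail is the constant tail from t/2 minus the integral from t/2 to x, to which the
    fundamental theorem applies. The base point t/2 stays positive, where the tail converges. *)
Lemma is_derive_rltail t : 0 < t -> {for t, continuous y} ->
  is_derive t 1 (rltail y) (- (y t / t ^+ 2)).
Proof.
move=> t0 cy.
have u0 : 0 < t / 2 by rewrite divr_gt0.
have ut : t / 2 < t by lra.
have t1 : t < t + 1 by rewrite ltrDl.
have i := integrable_rltail u0.
pose F x := \int[mu]_(s in [set` Interval (BRight (t / 2)) (BRight x)]) (y s / s ^+ 2).
have iu : mu.-integrable [set` Interval (BRight (t / 2)) (BRight (t + 1))]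
    (EFin \o (fun s => y s / s ^+ 2)).
  by apply: integrableS i => //; exact: subset_itvl.
have cf : {for t, continuous (fun s => y s / s ^+ 2)}.
  apply: (continuousM cy); exact: continuous_invsqr.
have ltu : (BRight (t / 2) < BRight t)%O by rewrite bnd_simp.
have [] := continuous_FTC1 t1 iu ltu cf.
rewrite -/F => D1 D2.
have D : is_derive t 1 F (y t / t ^+ 2).
  by apply: DeriveDef => //; rewrite -derive1E D2.
have DB : is_derive t 1 (fun x => rltail y (t / 2) - F x) (- (y t / t ^+ 2)).
  by have := is_deriveB (is_derive_cst (rltail y (t / 2)) t 1) D; rewrite sub0r.
apply: near_eq_is_derive DB.
near=> x.
rewrite /F /rltail Rintegral_itvB//.
  by rewrite bnd_simp; apply: ltW; near: x; exact: lt_nbhsr.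
Unshelve. all: by end_near. Qed.
End bounded.

Lemma rltailB a M N y z t : a <= 1 -> 0 <= M -> 0 <= N -> 0 < t ->
  measurable_fun setT (cutpos y) -> measurable_fun setT (cutpos z) ->
  (forall s, 0 < s -> `|y s| <= M * s `^ (a - 1)) ->
  (forall s, 0 < s -> `|z s| <= N * s `^ (a - 1)) ->
  rltail (y \- z) t = rltail y t - rltail z t.
Proof.
move=> a1 M0 N0 t0 my mz yM zN; rewrite /rltail -RintegralB//.
- by apply: eq_Rintegral => s _; rewrite /= mulrBl.
- exact: integrable_rltail my yM _ t0.
- exact: integrable_rltail mz zN _ t0.
Qed.
End tail.

(** * Picard iteration in a weighted norm *)

Section picard.
Context {R : realType}.
Implicit Types (x z : R -> R).

(** The contraction principle for the distance sup |x - z| / w on the open half-line, without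
    forming a function space: completeness is replaced by closure of [P] under limits attained at
    the rate k^n. *)
Lemma weighted_fixpoint (P : (R -> R) -> Prop) (Phi : (R -> R) -> R -> R)
    (w x0 : R -> R) (k : R) : 0 <= k -> k < 1 ->
  (forall t, 0 < t -> 0 <= w t) ->
  P x0 -> (forall x, P x -> P (Phi x)) ->
  (exists2 M, 0 <= M & forall t, 0 < t -> `|Phi x0 t - x0 t| <= M * w t) ->
  (forall x z M, P x -> P z -> 0 <= M ->
    (forall t, 0 < t -> `|x t - z t| <= M * w t) ->
    forall t, 0 < t -> `|Phi x t - Phi z t| <= k * M * w t) ->
  (forall (x_ : nat -> R -> R) x M, 0 <= M -> (forall n, P (x_ n)) ->
    (forall n t, 0 < t -> `|x_ n t - x t| <= M * k ^+ n * w t) -> P x) ->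
  exists2 x, P x & forall t, 0 < t -> Phi x t = x t.
Proof.
move=> k0 k1 w0 Px0 PPhi [M M0 xM] ctr Plim.
pose x_ n := iter n Phi x0.
have Px n : P (x_ n) by elim: n => //= n; exact: PPhi.
have step n t : 0 < t -> `|x_ n.+1 t - x_ n t| <= M * k ^+ n * w t.
  elim: n t => [|n IH] t t0; first by rewrite expr0 mulr1; exact: xM.
  have D0 : 0 <= M * k ^+ n by rewrite mulr_ge0// exprn_ge0.
  by rewrite exprS mulrCA; exact: (ctr _ _ _ (Px _) (Px _) D0 IH t t0).
have k1' : 0 < 1 - k by rewrite subr_gt0.
(* Keeping the factor 1 - k^m of the finite geometric sum is what lets the induction on m close. *)
have tele n m t : 0 < t ->
    `|x_ (n + m)%N t - x_ n t| <= M / (1 - k) * k ^+ n * w t * (1 - k ^+ m).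
  move=> t0; elim: m => [|m IH].
    by rewrite addn0 subrr normr0 expr0 subrr mulr0.
  have -> : x_ (n + m.+1)%N t - x_ n t =
      (x_ (n + m).+1 t - x_ (n + m)%N t) + (x_ (n + m)%N t - x_ n t).
    by rewrite addnS; ring.
  apply: le_trans (ler_normD _ _) _; apply: le_trans (lerD (step _ _ t0) IH) _.
  rewrite le_eqVlt; apply/orP; left; apply/eqP; rewrite exprD exprS; field.
  by rewrite gt_eqF.
have tele' n m t : 0 < t -> (n <= m)%N ->
    `|x_ m t - x_ n t| <= M / (1 - k) * k ^+ n * w t.
  move=> t0 nm; rewrite -(subnKC nm); apply: le_trans (tele _ _ _ t0) _.
  rewrite -[leRHS]mulr1 ler_wpM2l ?gerBl ?exprn_ge0//.
  by rewrite !mulr_ge0 ?invr_ge0 ?exprn_ge0 ?w0// ltW.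
pose x t := limn (fun n => x_ n t).
have cvgk (c : R) : (fun n => c * k ^+ n) @ \oo --> (0 : R).
  by apply: cvg_geometric; rewrite ger0_norm.
have cvgx t : 0 < t -> cvgn (fun n => x_ n t).
  move=> t0; apply: cauchy_cvg; apply: cauchy_exP => e e0.
  have [N _ HN] := (@cvgrPdist_lt _ _ _ _ _ _ _).1 (cvgk (M / (1 - k) * w t)) e e0.
  exists (x_ N t); exists N => // n /= Nn; rewrite /ball/= distrC.
  apply: le_lt_trans (tele' _ _ _ t0 Nn) _.
  have := HN N (leqnn N); rewrite /= sub0r normrN mulrAC; apply: le_lt_trans.
  exact: ler_norm.
have xlim n t : 0 < t -> `|x_ n t - x t| <= M / (1 - k) * k ^+ n * w t.
  move=> t0.
  have : (fun m => `|x_ n t - x_ m t|) @ \oo --> `|x_ n t - x t|.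
    by apply: cvg_norm; apply: cvgB; [exact: cvg_cst|exact: cvgx].
  move=> /cvg_lim <- //; apply: limr_le.
    by apply: is_cvg_norm; apply: is_cvgB; [exact: is_cvg_cst|exact: cvgx].
  near=> m; rewrite distrC; apply: tele' => //.
  by near: m; exists n.
have D0 : 0 <= M / (1 - k) by rewrite divr_ge0// ltW.
have Pxx : P x by apply: Plim D0 Px xlim.
exists x => // t t0.
apply/eqP; rewrite -subr_eq0 -normr_le0.
(* Both [Phi x] and x are compared with the iterate of index n + 1; each distance is at most M / (1
   - k) k^(n+1) w(t), so their sum lies below this null sequence. *)
have : (fun n => (2 * (M / (1 - k)) * w t) * k ^+ n) @ \oo --> (0 : R) by exact: cvgk.
move=> /cvg_lim <- //; apply: limr_ge.
  by apply/cvg_ex; exists 0; exact: cvgk.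
near=> n.
have -> : Phi x t - x t = (Phi x t - Phi (x_ n) t) + (x_ n.+1 t - x t).
  by rewrite /x_ /=; ring.
apply: le_trans (ler_normD _ _) _.
have h1 : `|Phi x t - Phi (x_ n) t| <= k * (M / (1 - k) * k ^+ n) * w t.
  apply: ctr => //; first by rewrite mulr_ge0// exprn_ge0.
  by move=> s s0; rewrite distrC; exact: xlim.
apply: le_trans (lerD h1 (xlim _ _ t0)) _; rewrite exprS.
have -> : k * (M / (1 - k) * k ^+ n) * w t + M / (1 - k) * (k * k ^+ n) * w t =
   k * ((2 * (M / (1 - k)) * w t) * k ^+ n) by ring.
have E0 : 0 <= 2 * (M / (1 - k)) * w t * k ^+ n.
  by rewrite mulr_ge0 ?exprn_ge0// mulr_ge0 ?w0// mulr_ge0.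
by rewrite ler_piMl// ltW.
Unshelve. all: by end_near. Qed.
End picard.

(** * Estimates *)

Section estimates.
Context {R : realType}.
Notation mu := (@lebesgue_measure R).
Implicit Types (a b s t : R) (g h : R -> R).

Let itv_kernelE b h t s : s \in `]0%R, t[%classic ->
  cutpos h s * rlk b (t - s) = h s / (t - s) `^ (1 - b).
Proof.
rewrite inE/= in_itv/= => /andP[s0 st].
rewrite cutpos_gt0// rlk_gt0 ?subr_gt0//; congr (_ * _).
by rewrite -powRN; congr (_ `^ _); ring.
Qed.

Let measurable_itv_kernel b h t : measurable_fun setT (cutpos h) ->
  measurable_fun `]0%R, t[ (fun s => h s / (t - s) `^ (1 - b)).
Proof.
move=> mh; apply: (eq_measurable_fun _ (@itv_kernelE b h t)).
by apply: measurable_funTS; exact: measurable_rlconv_integrand.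
Qed.

Lemma measurable_cutpos_norm g : measurable_fun setT (cutpos g) ->
  measurable_fun setT (cutpos (fun s => `|g s|)).
Proof.
move=> mg; have -> : cutpos (fun s => `|g s|) = (fun s => `|cutpos g s|).
  by apply/funext => s; rewrite /cutpos; case: ifPn => //; rewrite normr0.
exact: measurableT_comp.
Qed.

(** This is how the two suprema of the theorem enter: h will be s |a(s)| for the linear term and
    |a(s)| s^(alpha-1) for differences. *)
Lemma rlconv_dominated_le b g h t M S : 0 < t -> 0 <= M ->
  measurable_fun setT (cutpos g) -> measurable_fun setT (cutpos h) ->
  (forall s, 0 < s -> 0 <= h s) ->
  (forall s, 0 < s -> `|g s| <= M * h s) ->
  (\int[mu]_(s in `]0%R, t[) (h s / (t - s) `^ (1 - b))%:E <= S%:E)%E ->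
  `|rlconv b g t| <= M * S.
Proof.
move=> t0 M0 mg mh h0 gh hS; apply: rlconv_itv_le => //.
apply: (@le_trans _ _ (M%:E * \int[mu]_(s in `]0%R, t[) (h s / (t - s) `^ (1 - b))%:E)%E).
  rewrite -ge0_integralZl//.
  - apply: ge0_le_integral => //.
    + by move=> s _; rewrite lee_fin mulr_ge0// invr_ge0 powR_ge0.
    + apply/measurable_EFinP; apply: measurable_itv_kernel.
      exact: measurable_cutpos_norm.
    + by apply: measurable_funeM; apply/measurable_EFinP; exact: measurable_itv_kernel.
    + move=> s; rewrite /= in_itv/= => /andP[s0 _].
      by rewrite -EFinM lee_fin mulrA ler_wpM2r ?invr_ge0 ?powR_ge0// gh.
  - by apply/measurable_EFinP; exact: measurable_itv_kernel.
  - move=> s; rewrite /= in_itv/= => /andP[s0 _].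
    by rewrite lee_fin mulr_ge0 ?h0// invr_ge0 powR_ge0.
by rewrite EFinM lee_wpmul2l.
Qed.

Lemma rlconvZ a b g t c : 0 < a -> 0 < b -> tame a g ->
  rlconv b (fun s => c * g s) t = c * rlconv b g t.
Proof.
move=> a0 b0 tg; rewrite /rlconv -RintegralZl//; last exact: tame_integrable tg.
apply: eq_Rintegral => s _; rewrite mulrA; congr (_ * _).
by rewrite /cutpos; case: ifPn => // _; rewrite mulr0.
Qed.

(** The supremum is nonnegative by its term at t = 1, hence a real number once it is below +oo;
    dividing by the weight gives the pointwise bound. *)
Lemma weighted_sup (f : R -> \bar R) b : (forall t, 0 < t -> (0 <= f t)%E) ->
  (ereal_sup [set (t `^ (1 - b))%:E * f t | t in `]0%R, +oo[] < +oo)%E ->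
  exists S : R, [/\ 0 <= S,
    ereal_sup [set (t `^ (1 - b))%:E * f t | t in `]0%R, +oo[]%E = S%:E &
    forall t, 0 < t -> (f t <= (S * t `^ (b - 1))%:E)%E].
Proof.
move=> f0 soo; set E := [set _ | _ in _]%E in soo *.
have ub t : 0 < t -> ((t `^ (1 - b))%:E * f t <= ereal_sup E)%E.
  by move=> t0; apply: ereal_sup_ubound; exists t => //=; rewrite in_itv/= t0.
have s0 : (0 <= ereal_sup E)%E.
  by apply: le_trans (ub 1 ltr01); rewrite mule_ge0 ?f0// lee_fin powR_ge0.
have sE : (ereal_sup E = (fine (ereal_sup E))%:E)%E by rewrite fineK// ge0_fin_numE.
exists (fine (ereal_sup E)); split => //; first exact: fine_ge0.
move=> t t0; have := ub _ t0; rewrite {1}sE.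
have p0 : 0 < t `^ (1 - b) by exact: powR_gt0.
by rewrite -(opprB 1 b) powRN EFinM lee_pdivlMr// muleC.
Qed.

(** Near t the weight stays below w(t) + 1, so the convergence is uniform there and the usual
    argument with three thirds of epsilon applies. *)
Lemma continuous_of_geometric_limit (x_ : nat -> R -> R) x (w : R -> R) (M k : R) t :
  0 <= M -> 0 <= k -> k < 1 -> 0 < t ->
  {for t, continuous w} -> (forall s, 0 < s -> 0 <= w s) ->
  (forall n, {for t, continuous (x_ n)}) ->
  (forall n s, 0 < s -> `|x_ n s - x s| <= M * k ^+ n * w s) ->
  {for t, continuous x}.
Proof.
move=> M0 k0 k1 t0 cw w0 cx lx.
apply/cvgrPdist_lt => e e0.
have e3 : 0 < e / 3 by rewrite divr_gt0.
have ck : (fun n => (M * (w t + 1)) * k ^+ n) @ \oo --> (0 : R).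
  by apply: cvg_geometric; rewrite ger0_norm.
have [n _ /(_ n (leqnn n))/=] := (@cvgrPdist_lt _ _ _ _ _ _ _).1 ck _ e3.
rewrite sub0r normrN => hn.
have {}hn : M * k ^+ n * (w t + 1) < e / 3.
  by rewrite (le_lt_trans (ler_norm _))//; apply: le_lt_trans hn; rewrite mulrAC.
have Mk0 : 0 <= M * k ^+ n by rewrite mulr_ge0 ?exprn_ge0.
have close s : 0 < s -> w s < w t + 1 -> `|x_ n s - x s| < e / 3.
  move=> s0 ws; apply: le_lt_trans (lx n s s0) _; apply: le_lt_trans hn.
  by rewrite ler_wpM2l// ltW.
have wt : w t < w t + 1 by rewrite ltrDl.
near=> s.
have s0 : 0 < s by near: s; exact: lt_nbhsr.
have ws : w s < w t + 1 by near: s; exact: (cvgr_lt _ cw).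
have xs : `|x_ n t - x_ n s| < e / 3.
  by near: s; exact: ((@cvgrPdist_lt _ _ _ _ _ _ _).1 (cx n) _ e3).
have -> : x t - x s = - (x_ n t - x t) + (x_ n t - x_ n s) + (x_ n s - x s) by ring.
apply: le_lt_trans (ler_normD _ _) _; apply: le_lt_trans (lerD (ler_normD _ _) (lexx _)) _.
rewrite normrN; have := close _ t0 wt; have := close _ s0 ws; move: xs; lra.
Unshelve. all: by end_near. Qed.
End estimates.

(** * The integral equation *)

Section equation.
Context {R : realType}.
Notation mu := (@lebesgue_measure R).
Implicit Types (x z : R -> R) (s t T M : R).
(** In the application [S] is the supremum of the first integral condition and [X] is chi. *)
Variables (alpha : R) (a : R -> R) (S X b : R).
Hypotheses (alpha0 : 0 < alpha) (alpha1 : alpha < 1).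
Hypothesis a_cont : forall t : R, 0 < t -> {for t, continuous a}.
Hypothesis a_bnd : forall T : R, 0 < T ->
  exists2 A, 0 <= A & forall s, 0 < s -> s <= T -> `|a s| <= A.
Hypotheses (S0 : 0 <= S) (X0 : 0 <= X).
Hypothesis aS : forall t, 0 < t ->
  (\int[mu]_(s in `]0%R, t[) (s * `|a s| / (t - s) `^ (1 - alpha))%:E
   <= (S * t `^ (alpha - 1))%:E)%E.
Hypothesis aX : forall t, 0 < t ->
  (\int[mu]_(s in `]0%R, t[) (`|a s| / ((t - s) `^ (1 - alpha) * s `^ (1 - alpha)))%:E
   <= (X * t `^ (alpha - 1))%:E)%E.
Hypothesis X_lt : (Gamma alpha)^-1 * X < 1.

Let G0 : 0 < Gamma alpha. Proof. exact: Gamma_gt0. Qed.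

(** The weighted bound is imposed on the whole half-line: it encodes the asymptotics at infinity and
    also limits the blow-up at 0 to t^(alpha-1). *)
Definition admissible (x : R -> R) := (forall t, 0 < t -> {for t, continuous x}) /\
  exists2 M, 0 <= M & forall t, 0 < t -> `|x t - b * t| <= M * t `^ (alpha - 1).

(** This is [-y] in the notation of the header. *)
Definition potential (x : R -> R) (t : R) : R :=
  (Gamma alpha)^-1 * rlconv alpha (fun s => a s * x s) t.

(** The tail enters with a plus sign because [potential] is -y. *)
Definition picard_map (x : R -> R) (t : R) : R := b * t + t * rltail (potential x) t.

Let powR_cont (p t : R) : 0 < t -> {for t, continuous (fun s : R => s `^ p)}.
Proof.
move=> t0; apply: differentiable_continuous; apply/derivable1_diffP.
by apply: derivable_powR; rewrite in_itv/= t0.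
Qed.

Let ax_cont x t : admissible x -> 0 < t -> {for t, continuous (fun s => a s * x s)}.
Proof. by move=> [cx _] t0; apply: continuousM; [exact: a_cont|exact: cx]. Qed.

Lemma admissible_tame x : admissible x -> tame alpha (fun s => a s * x s).
Proof.
move=> ax; split; first by apply: measurable_cutpos => s; exact: ax_cont.
move=> T T0; have [_ [M M0 xM]] := ax; have [A A0 aA] := a_bnd T0.
exists (A * (`|b| * T `^ (2 - alpha) + M)).
  by rewrite mulr_ge0// addr_ge0// mulr_ge0// powR_ge0.
move=> s s0 sT; rewrite normrM -mulrA ler_pM//; first exact: aA.
have -> : x s = b * s + (x s - b * s) by ring.
apply: le_trans (ler_normD _ _) _; rewrite mulrDl lerD ?xM//.
rewrite normrM -mulrA ler_wpM2l// gtr0_norm//.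
(* The linear term is absorbed into the weight: s = s^(2-alpha) s^(alpha-1) <= T^(2-alpha)
   s^(alpha-1) on ]0, T]. *)
have E : s = s `^ (2 - alpha) * s `^ (alpha - 1) :> R.
  rewrite -powRD ?(gt_eqF s0) ?implybT//.
  by rewrite (_ : _ + _ = 1) ?powRr1 ?ltW//; ring.
rewrite {1}E ler_wpM2r ?powR_ge0//.
have p0 : 0 <= 2 - alpha by rewrite subr_ge0 (le_trans (ltW alpha1))// ler1n.
by rewrite ge0_ler_powR ?nnegrE ?(ltW s0) ?(ltW T0).
Qed.

Lemma admissible_linear : admissible (fun t => b * t).
Proof.
split; first by move=> t _; exact: mulrl_continuous.
by exists 0 => // t _; rewrite subrr normr0 mul0r.
Qed.

Lemma potential_contraction x z M : admissible x -> admissible z -> 0 <= M ->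
  (forall t, 0 < t -> `|x t - z t| <= M * t `^ (alpha - 1)) ->
  forall t, 0 < t ->
    `|potential x t - potential z t| <= (Gamma alpha)^-1 * X * M * t `^ (alpha - 1).
Proof.
move=> ax az M0 xz t t0; rewrite /potential -mulrBr normrM gtr0_norm ?invr_gt0//.
rewrite -!mulrA ler_wpM2l ?invr_ge0 ?(ltW G0)//.
rewrite -(rlconvB t alpha0 alpha0 (admissible_tame ax) (admissible_tame az)).
have -> : X * (M * t `^ (alpha - 1)) = M * (X * t `^ (alpha - 1)) by ring.
apply: (@rlconv_dominated_le R alpha _ (fun s => `|a s| * s `^ (alpha - 1))) => //.
- apply: measurable_cutpos => s s0.
  by apply: (@continuousB R R); exact: ax_cont.
- apply: measurable_cutpos => s s0; apply: continuousM; last exact: powR_cont.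
  by apply: (@continuous_comp R R R a (@Num.norm R R)); [exact: a_cont|exact: norm_continuous].
- by move=> s s0; rewrite mulr_ge0// powR_ge0.
- move=> s s0 /=; rewrite -mulrBr normrM mulrCA ler_wpM2l//; exact: xz.
(* The weight s^(alpha-1), written as 1 / s^(1-alpha), joins the kernel and yields the integrand of
   chi. *)
- move: (aX t0); congr (_ <= _)%E; apply: eq_integral => s _.
  congr EFin; have -> : s `^ (alpha - 1) = (s `^ (1 - alpha))^-1 by rewrite -powRN opprB.
  by rewrite invfM [_^-1 * _]mulrC mulrA.
Qed.

Lemma potential_linear_le t : 0 < t ->
  `|potential (fun t => b * t) t| <= (Gamma alpha)^-1 * (`|b| * S) * t `^ (alpha - 1).
Proof.
move=> t0; rewrite /potential normrM gtr0_norm ?invr_gt0//.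
rewrite -!mulrA ler_wpM2l ?invr_ge0 ?(ltW G0)//.
apply: (@rlconv_dominated_le R alpha _ (fun s => s * `|a s|)) => //.
- by apply: measurable_cutpos => s s0; apply: ax_cont => //; exact: admissible_linear.
- apply: measurable_cutpos => s s0; apply: continuousM; first exact: cvg_id.
  by apply: (@continuous_comp R R R a (@Num.norm R R)); [exact: a_cont|exact: norm_continuous].
- by move=> s s0; rewrite mulr_ge0// ltW.
- by move=> s s0 /=; rewrite !normrM (gtr0_norm s0) mulrC -mulrA.
- exact: aS.
Qed.

(** Comparison with b t: the difference is controlled by chi, the linear term by the first
    supremum. *)
Lemma potential_le x : admissible x ->
  exists2 M, 0 <= M & forall t, 0 < t -> `|potential x t| <= M * t `^ (alpha - 1).
Proof.
move=> ax; have [_ [M M0 xM]] := ax.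
exists ((Gamma alpha)^-1 * X * M + (Gamma alpha)^-1 * (`|b| * S)).
  by rewrite addr_ge0// ?mulr_ge0// ?invr_ge0 ltW.
move=> t t0.
have -> : potential x t = (potential x t - potential (fun t => b * t) t) +
  potential (fun t => b * t) t by ring.
apply: le_trans (ler_normD _ _) _; rewrite mulrDl lerD ?potential_linear_le//.
exact: potential_contraction admissible_linear _ _ _ _.
Qed.

Lemma potential_continuous x t : admissible x -> 0 < t ->
  {for t, continuous (potential x)}.
Proof.
move=> ax t0.
apply: (@continuous_comp R R R (rlconv alpha (fun s => a s * x s)) ( *%R (Gamma alpha)^-1)).
  apply: (rlconv_continuous alpha0 (ltW alpha1) alpha0 (admissible_tame ax)) => // s s0.
  exact: ax_cont.
exact: mulrl_continuous.
Qed.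

Let measurable_potential x : admissible x -> measurable_fun setT (cutpos (potential x)).
Proof. by move=> ax; apply: measurable_cutpos => s; exact: potential_continuous. Qed.

Lemma is_derive_picard_map x t : admissible x -> 0 < t ->
  is_derive t 1 (picard_map x) (b + rltail (potential x) t - potential x t / t).
Proof.
move=> ax t0; have [M M0 pM] := potential_le ax.
have D := is_derive_rltail (ltW alpha1) M0 (measurable_potential ax) pM t0
  (potential_continuous ax t0).
have D1 : is_derive t 1 (fun s : R => s * rltail (potential x) s)
    (t *: (- (potential x t / t ^+ 2)) + rltail (potential x) t *: 1).
  exact: (is_deriveM (is_derive_id t 1) D).
have D2 : is_derive t 1 (fun s : R => b * s) (b *: 1).
  exact: (is_deriveZ b (is_derive_id t 1)).
have D3 := is_deriveD D2 D1.
apply: is_derive_eq; rewrite /GRing.scale/= !mulr1; field.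
by rewrite gt_eqF.
Qed.

Lemma admissible_picard_map x : admissible x -> admissible (picard_map x).
Proof.
move=> ax; split.
  move=> t t0; have [D _] := is_derive_picard_map ax t0.
  by apply: differentiable_continuous; exact/derivable1_diffP.
have [M M0 pM] := potential_le ax; exists M => // t t0.
rewrite /picard_map addrAC subrr add0r.
exact: rltail_le (ltW alpha1) M0 (measurable_potential ax) pM _ t0.
Qed.

Lemma picard_map_contraction x z M : admissible x -> admissible z -> 0 <= M ->
  (forall t, 0 < t -> `|x t - z t| <= M * t `^ (alpha - 1)) ->
  forall t, 0 < t ->
    `|picard_map x t - picard_map z t| <= (Gamma alpha)^-1 * X * M * t `^ (alpha - 1).
Proof.
move=> ax az M0 xz t t0.
have -> : picard_map x t - picard_map z t =
    t * (rltail (potential x) t - rltail (potential z) t).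
  by rewrite /picard_map opprD addrACA subrr add0r mulrBr.
have [Mx Mx0 xM] := potential_le ax; have [Mz Mz0 zM] := potential_le az.
rewrite -(rltailB (ltW alpha1) Mx0 Mz0 t0 _ _ xM zM); try exact: measurable_potential.
apply: rltail_le => //; first exact: ltW.
- by rewrite !mulr_ge0// invr_ge0 ltW.
- apply: measurable_cutpos => s s0.
  by apply: (@continuousB R R); exact: potential_continuous.
- exact: potential_contraction.
Qed.

Lemma picard_fixpoint : exists2 x, admissible x &
  forall t, 0 < t -> picard_map x t = x t.
Proof.
have k0 : 0 <= (Gamma alpha)^-1 * X by rewrite mulr_ge0// invr_ge0 ltW.
apply: (weighted_fixpoint (w := fun t => t `^ (alpha - 1)) k0 X_lt _
  admissible_linear admissible_picard_map).
- by move=> t _; exact: powR_ge0.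
- have [_ [M M0 xM]] := admissible_picard_map admissible_linear.
  by exists M.
- exact: picard_map_contraction.
- move=> x_ x M M0 ax lx; split.
    move=> t t0; apply: (@continuous_of_geometric_limit R x_ x
      (fun t => t `^ (alpha - 1)) M _ t M0 k0 X_lt t0) => //.
    + exact: powR_cont.
    + by move=> s _; exact: powR_ge0.
    + by move=> n; apply: (ax n).1.
  (* A single iterate suffices: the limit is within weighted distance M of [x_ 0], itself within M'
     of b t. *)
  have [_ [M' M'0 xM]] := ax 0%N.
  exists (M + M'); first by rewrite addr_ge0.
  move=> t t0; have -> : x t - b * t = - (x_ 0%N t - x t) + (x_ 0%N t - b * t) by ring.
  apply: le_trans (ler_normD _ _) _; rewrite normrN mulrDl lerD ?xM//.
  by have := lx 0%N t t0; rewrite expr0 mulr1.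
Qed.

Lemma derive1_picard_map x t : admissible x -> 0 < t ->
  derive1 (picard_map x) t = b + rltail (potential x) t - potential x t / t.
Proof.
by move=> ax t0; rewrite derive1E; have [_ ->] := is_derive_picard_map ax t0.
Qed.

Lemma continuous_derive1_picard_map x t : admissible x -> 0 < t ->
  {for t, continuous (derive1 (picard_map x))}.
Proof.
move=> ax t0; have [M M0 pM] := potential_le ax.
have cT : {for t, continuous (rltail (potential x))}.
  have [D _] := is_derive_rltail (ltW alpha1) M0 (measurable_potential ax) pM t0
    (potential_continuous ax t0).
  by apply: differentiable_continuous; exact/derivable1_diffP.
have cI : {for t, continuous (fun s : R => s^-1)}.
  by apply: inv_continuous; rewrite gt_eqF.
have c : {for t, continuous (fun s => b + rltail (potential x) s - potential x s / s)}.
  apply: (@continuousB R R).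
    by apply: (@continuousD R R) => //; exact: cst_continuous.
  by apply: continuousM => //; exact: potential_continuous.
rewrite /prop_for /continuous_at derive1_picard_map//.
apply: cvg_trans c; apply: near_eq_cvg; near=> s.
by rewrite derive1_picard_map//; near: s; exact: lt_nbhsr.
Unshelve. all: by end_near. Qed.

Lemma euler_picard_map x t : admissible x -> 0 < t ->
  t * derive1 (picard_map x) t - picard_map x t = - potential x t.
Proof.
move=> ax t0; rewrite derive1_picard_map// /picard_map; field.
by rewrite gt_eqF.
Qed.

(** The function is -I^alpha (a x), so the semigroup law turns its integral of order 1 - alpha into
    one of order 1; the Beta constant Gamma(alpha) Gamma(1 - alpha) cancels the factor 1 /
    Gamma(alpha) of [potential]. *)
Lemma RL_integral_euler x : admissible x ->
  RL_integral_part alpha (fun t => t * derive1 (picard_map x) t - picard_map x t) =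
  (fun t => - Gamma (1 - alpha) * rlconv 1 (fun s => a s * x s) t).
Proof.
move=> ax; apply/funext => t.
have b0 : 0 < 1 - alpha by rewrite subr_gt0.
have tg := admissible_tame ax.
transitivity (rlconv (1 - alpha)
    (fun t => t * derive1 (picard_map x) t - picard_map x t) t).
  by rewrite rlconvE /RL_integral_part subKr.
have [M M0 pM] := potential_le ax.
have tp : tame alpha (rlconv alpha (fun s => a s * x s)).
  split; first by apply: measurable_cutpos => s s0;
    apply: (rlconv_continuous alpha0 (ltW alpha1) alpha0 tg) => // r; exact: ax_cont.
  move=> T _; exists (Gamma alpha * M); first by rewrite mulr_ge0// ltW.
  move=> s s0 _; rewrite -mulrA mulrC -ler_pdivrMr//.
  have := pM s s0; rewrite /potential normrM gtr0_norm ?invr_gt0//.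
  by rewrite mulrC.
rewrite (@eq_rlconv _ _ _
  (fun s => - (Gamma alpha)^-1 * rlconv alpha (fun s => a s * x s) s)); last first.
  by move=> s s0; rewrite euler_picard_map// /potential mulNr.
rewrite (rlconvZ _ _ alpha0 b0 tp) (rlconv_rlconv _ alpha0 alpha0 b0 tg).
rewrite subrKC mulrA; congr (_ * _).
rewrite -(Gamma_reflection alpha0 alpha1)/= mulrA mulNr mulVf ?mulN1r//.
by rewrite gt_eqF.
Qed.

Lemma is_derive_RL_integral_euler x t : admissible x -> 0 < t ->
  is_derive t 1 (RL_integral_part alpha
      (fun t => t * derive1 (picard_map x) t - picard_map x t))
    (- Gamma (1 - alpha) * (a t * x t)).
Proof.
move=> ax t0; rewrite RL_integral_euler//.
have D := is_derive_rlconv1 alpha0 (admissible_tame ax) t0 (ax_cont ax t0).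
exact: (is_deriveZ (- Gamma (1 - alpha)) D).
Qed.

(** The global bound t^(alpha-1) gives only boundedness here. Near 0 tameness gives a x =
    O(s^(alpha-1)), so its integral of order alpha is O(t^(2 alpha - 1)), and the weighted function
    is O(t^alpha). *)
Lemma cvg_euler_at0 x : admissible x ->
  (fun t => t `^ (1 - alpha) * (t * derive1 (picard_map x) t - picard_map x t))
    @ 0^'+ --> (0 : R).
Proof.
move=> ax; have tg := admissible_tame ax.
have [C C0 gC] := tg.2 1 ltr01.
pose D := (Gamma alpha)^-1 * (C * fine (rl_beta alpha alpha)).
have D0 : 0 <= D by rewrite !mulr_ge0 ?invr_ge0 ?(ltW G0)// fine_ge0// rl_beta_ge0.
have DD : (fun t => D * t `^ alpha) @ 0^'+ --> (0 : R).
  by rewrite -[X in _ --> X](mulr0 D); apply: cvgM; [exact: cvg_cst|exact: powR_cvg0].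
have ND : (fun t => - (D * t `^ alpha)) @ 0^'+ --> (0 : R).
  by rewrite -[X in _ --> X]oppr0; exact: cvgN.
apply: (squeeze_cvgr _ ND DD); near=> t.
have t0 : 0 < t by [].
have t1 : t <= 1 by near: t; exact: nbhs_right_le.
rewrite -ler_norml euler_picard_map// mulrN normrN normrM ger0_norm ?powR_ge0//.
have le := @rlconv_le R alpha alpha _ t C alpha0 alpha0 tg t0 C0
  (fun s ps st => gC s ps (le_trans st t1)).
rewrite /potential normrM gtr0_norm ?invr_gt0// mulrCA /D -mulrA.
rewrite ler_wpM2l ?invr_ge0 ?(ltW G0)//.
apply: le_trans (ler_wpM2l (powR_ge0 _ _) le) _.
rewrite mulrCA ler_wpM2l ?mulr_ge0 ?fine_ge0 ?rl_beta_ge0//.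
rewrite -powRD ?(gt_eqF t0) ?implybT//.
by rewrite (_ : _ + _ = alpha)//; ring.
Unshelve. all: by end_near. Qed.

Lemma exists_solution (c : R) : exists x : R -> R,
  [/\ forall t, 0 < t -> derivable x t 1,
    forall t, 0 < t -> {for t, continuous (derive1 x)},
    RL_differentiable alpha (fun t => t * derive1 x t - x t),
    forall t, 0 < t ->
      RL_deriv alpha (fun t => t * derive1 x t - x t) t + a t * x t = 0 &
    exists M T : R, forall t, T <= t ->
      `|x t - (c * t `^ (alpha - 1) + b * t)| <= M * t `^ (alpha - 1)].
Proof.
have [x ax xE] := picard_fixpoint.
(* The image is used rather than x: the two agree only for t > 0, and the derivative formulas are
   stated for the image. *)
exists (picard_map x); split.
- by move=> t t0; have [] := is_derive_picard_map ax t0.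
- by move=> t t0; exact: continuous_derive1_picard_map.
- split; first by exists 0; exact: cvg_euler_at0.
  by move=> t t0; have [] := is_derive_RL_integral_euler ax t0.
- move=> t t0; rewrite /RL_deriv derive1E.
  have [_ ->] := is_derive_RL_integral_euler ax t0.
  have G1 : 0 < Gamma (1 - alpha) by rewrite Gamma_gt0 ?subr_gt0// gtrBl.
  (* The derivative yields a(t) x(t) with the fixed point, the equation asks for a(t) [picard_map x]
     t; [xE] identifies them. *)
  by rewrite xE// mulNr mulrN mulKf ?gt_eqF// addNr.
- have [_ [M M0 pM]] := admissible_picard_map ax.
  (* The summand |c| absorbs c t^(alpha-1); the bound holds for all t > 0, and T = 1 only ensures
     positivity. *)
  exists (M + `|c|), 1 => t t1; have t0 : 0 < t by exact: lt_le_trans t1.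
  have -> : picard_map x t - (c * t `^ (alpha - 1) + b * t) =
      (picard_map x t - b * t) - c * t `^ (alpha - 1) by ring.
  apply: le_trans (ler_normB _ _) _; rewrite mulrDl lerD ?pM//.
  by rewrite normrM (ger0_norm (powR_ge0 _ _)).
Qed.
End equation.

(** * From the stated hypotheses to the integral equation *)

Lemma within_continuous_bounded (R : realType) (a : R -> R) :
  {within `[0%R, +oo[, continuous a} -> forall T : R, 0 < T ->
  exists2 A, 0 <= A & forall s, 0 < s -> s <= T -> `|a s| <= A.
Proof.
move=> ca T T0.
(* Continuity up to the endpoint 0 makes compactness of [0, T] available, hence boundedness near
   0. *)
have cT : {within `[0%R, T], continuous a}.
  by apply: continuous_subspaceW ca; exact: subset_itvl.
have := compact_bounded (continuous_compact cT (@segment_compact _ _ _)).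
move=> /pinfty_ex_gt0[A A0 aA]; exists A; first exact: ltW.
move=> s s0 sT; apply: aA; exists s => //=.
by rewrite in_itv/= (ltW s0).
Qed.

Theorem theorem2 (R : realType) (alpha : R) (a : R -> R) :
  0 < alpha -> alpha < 1 ->
  {within `[0%R, +oo[, continuous a} ->
  ((\int[@lebesgue_measure R]_(t in `]0%R, +oo[) (t * `|a t|)%:E)
   + ereal_sup [set ((t `^ (1 - alpha))%:E *
        \int[@lebesgue_measure R]_(s in `]0%R, t[) (s * `|a s| / (t - s) `^ (1 - alpha))%:E)
      | t in `]0%R, +oo[] < +oo)%E ->
  (((Gamma alpha)^-1)%:E *
     ((\int[@lebesgue_measure R]_(s in `]0%R, +oo[) (`|a s| / s `^ (1 - alpha))%:E)
      + ereal_sup [set ((t `^ (1 - alpha))%:E *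
          \int[@lebesgue_measure R]_(s in `]0%R, t[)
             (`|a s| / ((t - s) `^ (1 - alpha) * s `^ (1 - alpha)))%:E)
        | t in `]0%R, +oo[]) < 1%:E)%E ->
  forall c b : R, b != 0 ->
  exists x : R -> R,
    (* x in C^1((0,+oo), R) *)
    (forall t, 0 < t -> derivable x t 1) /\
    {in `]0%R, +oo[, continuous (derive1 x)} /\
    (* the equation  0D_t^alpha (t x' - x) + a x = 0 for t > 0 *)
    RL_differentiable alpha (fun t => t * derive1 x t - x t) /\
    (forall t, 0 < t -> RL_deriv alpha (fun t => t * derive1 x t - x t) t + a t * x t = 0) /\
    (* x(t) = [c + O(1)] t^(alpha-1) + b t  as t -> +oo *)
    (exists M T : R, forall t, T <= t ->
       `|x t - (c * t `^ (alpha - 1) + b * t)| <= M * t `^ (alpha - 1)).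
Proof.
move=> alpha0 alpha1 ca HS HX c b _.
have G0 := Gamma_gt0 alpha0 alpha1.
have a_cont t : 0 < t -> {for t, continuous a}.
  move: ca => /continuous_within_itvcyP[ca _] t0.
  by apply: ca; rewrite in_itv/= t0.
have a_bnd := within_continuous_bounded ca.
have SF (t : R) : 0 < t -> (0 <= \int[@lebesgue_measure R]_(s in `]0%R, t[)
    (s * `|a s| / (t - s) `^ (1 - alpha))%:E)%E.
  move=> t0; apply: integral_ge0 => s; rewrite /= in_itv/= => /andP[s0 _].
  by rewrite lee_fin !mulr_ge0// ?(ltW s0)// invr_ge0 powR_ge0.
have XF (t : R) : 0 < t -> (0 <= \int[@lebesgue_measure R]_(s in `]0%R, t[)
    (`|a s| / ((t - s) `^ (1 - alpha) * s `^ (1 - alpha)))%:E)%E.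
  move=> t0; apply: integral_ge0 => s _.
  by rewrite lee_fin mulr_ge0// invr_ge0 mulr_ge0 ?powR_ge0.
have A0 : (0 <= \int[@lebesgue_measure R]_(s in `]0%R, +oo[) (`|a s| / s `^ (1 - alpha))%:E)%E.
  by apply: integral_ge0 => s _; rewrite lee_fin mulr_ge0// invr_ge0 powR_ge0.
have T0 : (0 <= \int[@lebesgue_measure R]_(t in `]0%R, +oo[) (t * `|a t|)%:E)%E.
  apply: integral_ge0 => s; rewrite /= in_itv/= andbT => s0.
  by rewrite lee_fin mulr_ge0// ltW.
(* The integral is nonnegative, so the supremum is at most the finite sum. *)
have [S [S0 _ aS]] := weighted_sup SF (le_lt_trans (leeDr _ T0) HS).
have Xoo : (ereal_sup [set ((t `^ (1 - alpha))%:E *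
    \int[@lebesgue_measure R]_(s in `]0%R, t[)
      (`|a s| / ((t - s) `^ (1 - alpha) * s `^ (1 - alpha)))%:E) | t in `]0%R, +oo[] < +oo)%E.
  (* If chi were infinite, so would be the sum, whose other term is nonnegative, and its product
     with 1 / Gamma(alpha) > 0. *)
  rewrite ltey; apply/eqP => Xy; move: HX; rewrite Xy addey.
    by rewrite gt0_muley ?lte_fin ?invr_gt0.
  by rewrite gt_eqF// (lt_le_trans ltNy0 A0).
have [X [X0 XE aX]] := weighted_sup XF Xoo.
(* As the integral next to chi is nonnegative, chi / Gamma(alpha) <= k_3 < 1. *)
have X_lt : (Gamma alpha)^-1 * X < 1.
  rewrite -lte_fin EFinM; apply: le_lt_trans HX; rewrite XE.
  by rewrite lee_wpmul2l ?leeDr// lee_fin invr_ge0 ltW.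
have [x [dx cx Dx eqx Ox]] :=
  exists_solution b alpha0 alpha1 a_cont a_bnd S0 X0 aS aX X_lt c.
exists x; split; first exact: dx.
split; last by split.
by move=> t; rewrite in_itv/= andbT; exact: cx.
Qed.
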